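(* Let $\mu=l_1+l_2+l_3$ be a symmetric Lie $2$-algebra structure on a graded vector space $E=E_{-2}\oplus E_{-1}$ such that $\chi=0$, i.e. $l_2(X,f)=0$ for all $X\in E_{-1}$, $f\in E_{-2}$. Then there exists a Nijenhuis vector valued form with respect to $\mu$ of the form $S+\alpha$, with $S$ the Euler map and $\alpha$ a symmetric vector valued $2$-form of degree zero, such that the deformed structure $[S+\alpha,l_1+l_2+l_3]_{_{RN}}$ is the direct sum of a string Lie algebra with a trivial Lie $2$-algebra.
   Context: Let $E=\oplus_{i\in\mathbb Z}E_i$ be a graded vector space over $\mathbb R$ or $\mathbb C$; $|X|$ is the degree of homogeneous $X$. A symmetric vector valued $k$-form is a graded symmetric $k$-linear map $K:E^{k}\to E$ (exchanging adjacent arguments $X,Y$ gives the sign $(-1)^{|X||Y|}$). It has degree $\bar K$ if $|K(X_1,\dots,X_k)|=|X_1|+\dots+|X_k|+\bar K$. For a $k$-form $K$ and $l$-form $L$, $$\iota_KL(X_1,\dots,X_{k+l-1})=\sum_{\sigma\in Sh(k,l-1)}\epsilon(\sigma)L(K(X_{\sigma(1)},\dots,X_{\sigma(k)}),X_{\sigma(k+1)},\dots,X_{\sigma(k+l-1)}),$$ with $Sh(k,l-1)$ the $(k,l-1)$-unshuffles and $\epsilon(\sigma)$ the Koszul sign. The Richardson–Nijenhuis bracket is $[K,L]_{_{RN}}=\iota_KL-(-1)^{\bar K\bar L}\iota_LK$, extended bilinearly to sums of forms. A symmetric $L_\infty$-structure is $\mu=\sum_{i\ge1}l_i$ with $l_i$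 a symmetric vector valued $i$-form of degree $+1$ and $[\mu,\mu]_{_{RN}}=0$. A symmetric Lie $2$-algebra is an $L_\infty$-algebra whose graded vector space is concentrated in degrees $-2,-1$ (so only $l_1,l_2,l_3$ can be non-zero). It is a string Lie algebra if $l_1=0$; it is trivial if $l_2=l_3=0$ and $l_1:E_{-2}\to E_{-1}$ is invertible. A structure on $E$ is the direct sum of two Lie $2$-algebras if $E=E^s\oplus E^t$ as graded vector spaces, with $E^s$ and $E^t$ closed under all brackets (the restrictions being the two given Lie $2$-algebras) and all brackets with arguments from both $E^s$ and $E^t$ vanishing. For $\mu$ of degree $1$, a symmetric vector valued form $\mathcal N$ of degree $0$ is Nijenhuis with respect to $\mu$ if there is $\mathcal K$ of degree $0$ with $[\mathcal N,[\mathcal N,\mu]_{_{RN}}]_{_{RN}}=[\mathcal K,\mu]_{_{RN}}$ and $[\mathcal N,\mathcal K]_{_{RN}}=0$. Euler map: $S(X)=-|X|X$ for homogeneous $X$. *)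

(* Defs.v *)
From HB Require Import structures.
From mathcomp Require Import all_boot all_order all_fingroup all_algebra.
From mathcomp Require Import reals.
From mathcomp Require Import complex.

Set Implicit Arguments.
Unset Strict Implicit.
Unset Printing Implicit Defensive.

Import GRing.Theory.
Local Open Scope ring_scope.

Variant base_field := RealNumbers | ComplexNumbers.

Definition scalars (R : realType) (b : base_field) : fieldType :=
  match b with
  | RealNumbers => R
  | ComplexNumbers => R[i]
  end.

(* A graded vector space is the family of its homogeneous components
   [E i], so that its underlying vector space is the direct sum of the [E i]. *)
Notation gradedSpace K := (int -> lmodType K).

Section Forms.
Variables (K : fieldType) (E : gradedSpace K).

(* Homogeneous vectors, together with their degree. *)
Definition hvec := {i : int & E i}.

Definition hv (i : int) (x : E i) : hvec := Tagged (fun i => (E i : Type)) x.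

Definition degree (x : hvec) : int := tag x.

Definition total_degree (X : seq hvec) : int := \sum_(x <- X) degree x.

Definition component (n : int) (x : hvec) : E n := untag (0 : E n) id x.

(* A (not necessarily arity-homogeneous) vector valued form is given by its
   values on lists of homogeneous vectors, which determine it by
   multilinearity: [F X n] is the component in [E n] of F(X_1, .., X_k),
   k = size X.  The restriction of F to the lists of size k is its k-form
   component, and F is the sum of these components. *)
Definition vform := seq hvec -> forall n : int, E n.

Definition vform_add (F G : vform) : vform := fun X n => F X n + G X n.

Definition multilinear (F : vform) : Prop :=
  forall (s t : seq hvec) (i : int) (a : K) (x y : E i) (n : int),
    F (s ++ hv (a *: x + y) :: t) n =
    a *: F (s ++ hv x :: t) n + F (s ++ hv y :: t) n.

Definition graded_symmetric (F : vform) : Prop :=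
  forall (s t : seq hvec) (x y : hvec) (n : int),
    F (s ++ x :: y :: t) n =
    ((-1) ^ (degree x * degree y)) *: F (s ++ y :: x :: t) n.

Definition has_degree (d : int) (F : vform) : Prop :=
  forall (X : seq hvec) (n : int), n != total_degree X + d -> F X n = 0.

(* Sums of symmetric k-forms of degree d, k >= 1. *)
Definition sym_form (d : int) (F : vform) : Prop :=
  [/\ multilinear F, graded_symmetric F, has_degree d F
    & forall n, F [::] n = 0].

Definition sym_kform (k : nat) (d : int) (F : vform) : Prop :=
  sym_form d F /\ forall X n, size X != k -> F X n = 0.

Definition unshuffle (n k : nat) (s : 'S_n) : bool :=
  [forall i : 'I_n, forall j : 'I_n,
     ((i < j) && ((j < k) || (k <= i)) ==> (s i < s j))%N].

(* X_1 . ... . X_n = koszul s * X_(s 1) . ... . X_(s n) in the graded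
   symmetric algebra: one factor for each inversion of s. *)
Definition koszul (X : seq hvec) (s : 'S_(size X)) : K :=
  \prod_(i < size X) \prod_(j < size X | ((i < j) && (s j < s i))%N)
    (-1) ^ (degree (tnth (in_tuple X) (s i)) *
            degree (tnth (in_tuple X) (s j))).

Definition first_args (X : seq hvec) (s : 'S_(size X)) (k : nat) : seq hvec :=
  [seq tnth (in_tuple X) (s i) | i : 'I_(size X) <- enum 'I_(size X) & (i < k)%N].

Definition last_args (X : seq hvec) (s : 'S_(size X)) (k : nat) : seq hvec :=
  [seq tnth (in_tuple X) (s i) | i : 'I_(size X) <- enum 'I_(size X) & (k <= i)%N].

(* iota_F G for F of degree p, extended bilinearly to sums of forms: on n
   arguments, the k-th summand is the insertion of the k-form component of F
   in the (n - k + 1)-form component of G. *)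
Definition insertion (p : int) (F G : vform) : vform := fun X n =>
  \sum_(1 <= k < (size X).+1) \sum_(s : 'S_(size X) | unshuffle k s)
    koszul s *:
      G (hv (F (first_args s k) (total_degree (first_args s k) + p))
           :: last_args s k) n.

(* F and G have degrees p and q; these are parameters because the zero form
   has every degree. *)
Definition rn_bracket (p q : int) (F G : vform) : vform := fun X n =>
  insertion p F G X n - ((-1) ^ (p * q)) *: insertion q G F X n.

Definition Linfty_structure (mu : vform) : Prop :=
  sym_form 1 mu /\ forall X n, rn_bracket 1 1 mu mu X n = 0.

Definition lie2_algebra (mu : vform) : Prop :=
  (forall i : int, i != -2 -> i != -1 -> forall x : E i, x = 0) /\
  Linfty_structure mu.

Definition string_lie_algebra (mu : vform) : Prop :=
  lie2_algebra mu /\ forall (x : hvec) n, mu [:: x] n = 0.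

Definition trivial_lie2_algebra (mu : vform) : Prop :=
  [/\ lie2_algebra mu,
      forall X n, size X = 2%N \/ size X = 3%N -> mu X n = 0
    & bijective (fun f : E (-2) => mu [:: hv f] (-1))].

Definition nijenhuis (mu N : vform) : Prop :=
  sym_form 0 N /\
  exists2 L : vform, sym_form 0 L &
    (forall X n, rn_bracket 0 1 N (rn_bracket 0 1 N mu) X n =
                 rn_bracket 0 1 L mu X n) /\
    (forall X n, rn_bracket 0 0 N L X n = 0).

(* The 1-form S(X) = -|X| X. *)
Definition euler : vform := fun X n =>
  if X is [:: x] then (- degree x)%:~R *: component n x else 0.

End Forms.
Arguments euler {K} E.

Definition hmap (K : fieldType) (E' E : gradedSpace K)
    (j : forall i, {linear E' i -> E i}) (x : hvec E') : hvec E :=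
  hv (j (tag x) (tagged x)).

(* [mu] on E is the direct sum of [mus] on Es and [mut] on Et, where Es and Et
   are identified with graded subspaces of E through the embeddings js, jt. *)
Definition direct_sum (K : fieldType) (E Es Et : gradedSpace K)
    (mu : vform E) (mus : vform Es) (mut : vform Et) : Prop :=
  exists (js : forall i, {linear Es i -> E i})
         (jt : forall i, {linear Et i -> E i}),
    [/\ forall i, bijective (fun p : Es i * Et i => js i p.1 + jt i p.2),
        forall X n, mu (map (hmap js) X) n = js n (mus X n),
        forall X n, mu (map (hmap jt) X) n = jt n (mut X n)
      & forall (X : seq (hvec Es + hvec Et)) n,
          has (fun z => if z is inl _ then true else false) X ->
          has (fun z => if z is inr _ then true else false) X ->
          mu [seq match z with inl x => hmap js x | inr y => hmap jt y end
             | z <- X] n = 0].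

(* Main.v *)
Require Import Defs.
From HB Require Import structures.
From mathcomp Require Import all_boot all_order all_fingroup all_algebra.
From mathcomp Require Import reals complex boolp zify ring.
From mathcomp Require classical_sets.

Set Implicit Arguments.
Unset Strict Implicit.
Unset Printing Implicit Defensive.

Import Order.TTheory GRing.Theory Num.Theory.
Local Open Scope ring_scope.

(** Write [mu = l_1 + l_2 + l_3] and [d = l_1 : E_(-2) -> E_(-1)].  When chi
vanishes, the higher brackets vanish on [E_(-2)], and the structure equations
reduce to the following: [l_2] and [l_3] vanish as soon as one argument lies in
the image of [d] ([exact_args]); the Jacobiator of [l_2] is [- d l_3]
([jacobi3]); and the insertion of [l_2] in [l_3] is zero ([jacobi4]).

Over a field [d] has a generalized inverse [h], so that [d h d = d] and
[h d h = h] ([generalized_inverse]; in infinite dimension this is a consequence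
of Zorn's lemma).  The 2-form of the theorem is [alpha (X, Y) = - h (l_2 (X, Y))].
It vanishes when one argument is in the image of [d].  Bracketing with the Euler
map multiplies a form by its degree, hence [S + alpha] sends [mu] to
[nu = mu + [alpha, mu]], where [alpha] changes [l_2] into [(1 - d h) l_2] and
subtracts from [l_3] the insertion of [l_2] in [alpha]
([bracket_euler_plus]).  The vanishing of [alpha] on the image of [d] makes
[alpha, [alpha, mu]] zero, so bracketing twice with [S + alpha] is bracketing
once with [S + 2 alpha] ([deform_twice]); and these two forms commute because
[S] commutes with forms of degree 0.  This is the Nijenhuis property
([nijenhuis_euler_plus]).

The maps [d h + h d] and [1 - d h - h d] are complementary graded projections.
On the image of the first, [d] is an isomorphism from degree -2 to degree -1, and
the higher brackets of [nu] vanish there, since the part of degree -1 is the image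
of [d] ([nu_tproj]).  On the image of the second [d] is zero, and it contains all
values of the higher brackets of [nu]: [(1 - d h) l_2] takes values in the kernel
of [d h], and [d] kills the new 3-form because the correction turns
[d l_3] into [d l_3 - d h d l_3] ([nu_cocycle], [tproj_nu]).  So [nu] is the
direct sum of its restrictions to the two images, one with zero differential and
the other with an invertible one.  That [nu] itself satisfies the structure
equation is checked on three and four arguments of degree -1 from the identities
for [mu] ([nu_jacobi]).

Insertions are defined by sums over unshuffles.  These are first rewritten as sums
over splittings of the argument list ([insertion_masks]), which can be expanded
for lists of length at most four; longer lists contribute nothing, by degree. *)

(** * Linear identities in abelian groups *)
(** Expanding insertions produces signed sums of up to fifteen terms.  Identities
between such sums are decided by comparing the integer coefficients of the atoms. *)
Inductive zexpr := ZVar of nat | ZZero | ZAdd of zexpr & zexpr | ZOpp of zexpr.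

Fixpoint zeval (V : zmodType) (env : seq V) (e : zexpr) : V :=
  match e with
  | ZVar i => env`_i
  | ZZero => 0
  | ZAdd e1 e2 => zeval env e1 + zeval env e2
  | ZOpp e1 => - zeval env e1
  end.

Fixpoint zcoef (e : zexpr) (i : nat) : int :=
  match e with
  | ZVar j => (i == j)%:Z
  | ZZero => 0
  | ZAdd e1 e2 => zcoef e1 i + zcoef e2 i
  | ZOpp e1 => - zcoef e1 i
  end.

Lemma zevalE (V : zmodType) (env : seq V) e :
  zeval env e = \sum_(i < size env) env`_i *~ zcoef e i.
Proof.
elim: e => [j||e1 IH1 e2 IH2|e IH] /=.
- have [lt_j|le_j] := ltnP j (size env); last first.
    rewrite nth_default // big1 // => i _.
    by case: eqVneq le_j => [<-|]; rewrite ?mulr0z // leqNgt ltn_ord.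
  rewrite (bigD1 (Ordinal lt_j)) //= eqxx mulr1z big1 ?addr0 // => i.
  by rewrite -val_eqE /= => /negbTE ->; rewrite mulr0z.
- by rewrite big1 // => i _; rewrite mulr0z.
- by rewrite IH1 IH2 -big_split; apply: eq_bigr => i _; rewrite mulrzDr.
- by rewrite IH -sumrN; apply: eq_bigr => i _; rewrite mulrNz.
Qed.

Lemma zeval_eq (V : zmodType) (env : seq V) n e1 e2 : size env = n ->
  all (fun i => zcoef e1 i == zcoef e2 i) (iota 0 n) ->
  zeval env e1 = zeval env e2.
Proof.
move=> <- /allP e12; rewrite !zevalE; apply: eq_bigr => i _.
by rewrite (eqP (e12 i _)) // mem_iota ltn_ord.
Qed.

(** Scalar multiples are compared through their two arguments, since the implicit
module structure may be presented in several convertible ways. *)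
Ltac zsame t u :=
  lazymatch t with
  | @GRing.scale _ _ ?a ?v =>
      lazymatch u with @GRing.scale _ _ ?b ?w => constr_eq a b; constr_eq v w end
  | _ => constr_eq t u
  end.
Ltac zindex t env :=
  lazymatch env with
  | ?u :: ?env' =>
      match constr:(Set) with
      | _ => let _ := match constr:(Set) with _ => zsame t u end in constr:(O)
      | _ => let i := zindex t env' in constr:(S i)
      end
  end.
Ltac zinsert t env :=
  match constr:(Set) with
  | _ => let i := zindex t env in env
  | _ => constr:(t :: env)
  end.
Ltac zatoms t env :=
  lazymatch t with
  | GRing.zero => env
  | @GRing.add _ ?a ?b => let env' := zatoms a env in zatoms b env'
  | @GRing.opp _ ?a => zatoms a env
  | _ => zinsert t env
  end.
Ltac zreify t env :=
  lazymatch t with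
  | GRing.zero => constr:(ZZero)
  | @GRing.add _ ?a ?b =>
      let a' := zreify a env in let b' := zreify b env in constr:(ZAdd a' b')
  | @GRing.opp _ ?a => let a' := zreify a env in constr:(ZOpp a')
  | _ => let i := zindex t env in constr:(ZVar i)
  end.
Ltac zmod :=
  match goal with
  | |- @eq ?V ?a ?b =>
      let T := type of a in
      let env0 := zatoms a (@nil T) in
      let env := zatoms b env0 in
      let a' := zreify a env in let b' := zreify b env in
      refine (@zeval_eq _ env _ a' b' erefl _); vm_compute; reflexivity
  end.

(** * Unshuffles and subsets *)
Section UnshuffleSets.
Variable n : nat.
Implicit Types (A : {set 'I_n}) (s : 'S_n) (P : pred 'I_n).

Let ord_ltn : rel 'I_n := fun i j => (i < j)%N.

Let ord_ltn_trans : transitive ord_ltn.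
Proof. by move=> j i k; apply: ltn_trans. Qed.

(** The order is the one of [enum], which is the order in which the arguments of a
form are listed. *)
Definition sorted_ords P : seq 'I_n := [seq i <- enum 'I_n | P i].

Lemma mem_sorted_ords P i : (i \in sorted_ords P) = P i.
Proof. by rewrite mem_filter mem_enum andbT. Qed.

Lemma sorted_sorted_ords P : sorted ord_ltn (sorted_ords P).
Proof.
apply: sorted_filter => //.
have := iota_ltn_sorted 0 n; rewrite -val_enum_ord sorted_map.
by apply: sub_sorted.
Qed.

Definition unshuffle_seq A : seq 'I_n :=
  sorted_ords (mem A) ++ sorted_ords (predC (mem A)).

Lemma size_unshuffle_seq A : size (unshuffle_seq A) = n.
Proof. by rewrite size_cat !size_filter count_predC size_enum_ord. Qed.

Lemma uniq_unshuffle_seq A : uniq (unshuffle_seq A).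
Proof.
have uniq_ords P : uniq (sorted_ords P) by rewrite filter_uniq ?enum_uniq.
rewrite cat_uniq !uniq_ords andbT; apply/hasPn => i.
by rewrite mem_sorted_ords => /= niA; rewrite [_ \in _]mem_sorted_ords.
Qed.

Definition unshuffle_fun A (i : 'I_n) : 'I_n := nth i (unshuffle_seq A) i.

Lemma unshuffle_fun_inj A : injective (unshuffle_fun A).
Proof.
move=> i j; rewrite /unshuffle_fun [RHS](set_nth_default i) ?size_unshuffle_seq //.
move/eqP; rewrite nth_uniq ?size_unshuffle_seq ?uniq_unshuffle_seq //.
by move/eqP/val_inj.
Qed.

Definition unshuffle_of A : 'S_n := perm (@unshuffle_fun_inj A).

(** The set of positions that a permutation moves to the front; it determines the
permutation when the latter is an unshuffle. *)
Definition initial_image k s : {set 'I_n} := [set s i | i : 'I_n & (i < k)%N].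

Lemma size_sorted_ords A : size (sorted_ords (mem A)) = #|A|.
Proof. by rewrite size_filter cardE -size_filter enumT. Qed.

Lemma unshuffle_ofE A (i : 'I_n) :
  unshuffle_of A i = if (i < #|A|)%N then nth i (sorted_ords (mem A)) i
                     else nth i (sorted_ords (predC (mem A))) (i - #|A|).
Proof. by rewrite permE /unshuffle_fun nth_cat size_sorted_ords. Qed.

Lemma card_initial k : (k <= n)%N -> #|[set i : 'I_n | (i < k)%N]| = k.
Proof.
move=> le_kn; rewrite -sum1dep_card.
by rewrite -(big_ord_widen _ (fun=> 1%N) le_kn) sum1_card card_ord.
Qed.

Lemma initial_image_unshuffle_of A : initial_image #|A| (unshuffle_of A) = A.
Proof.
apply/eqP; rewrite eqEcard card_imset; last exact: perm_inj.
rewrite card_initial ?leqnn ?andbT; last by rewrite -[n in (_ <= n)%N]card_ord max_card.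
apply/subsetP => _ /imsetP[i iA ->]; rewrite inE in iA.
have := mem_nth i (s := sorted_ords (mem A)) (n := i).
by rewrite size_sorted_ords iA mem_sorted_ords unshuffle_ofE iA; apply.
Qed.

Lemma unshuffle_unshuffle_of A : unshuffle #|A| (unshuffle_of A).
Proof.
apply/forallP => i; apply/forallP => j; apply/implyP => /andP[ij].
rewrite !unshuffle_ofE => /orP[jA|iA].
  rewrite jA (ltn_trans ij jA) (set_nth_default i j) ?size_sorted_ords //.
  by apply: (sorted_ltn_nth ord_ltn_trans i (sorted_sorted_ords (mem A)));
    rewrite ?inE ?size_sorted_ords ?(ltn_trans ij jA).
have jA : (#|A| <= j)%N := leq_trans iA (ltnW ij).
have sizeC : size (sorted_ords (predC (mem A))) = (n - #|A|)%N.
  have := size_unshuffle_seq A; rewrite size_cat size_sorted_ords.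
  by move=> /(congr1 (subn^~ #|A|)); rewrite addKn.
rewrite !ltnNge iA jA /= -ltnNge (set_nth_default i j); last first.
  by rewrite sizeC ltn_sub2r // (leq_ltn_trans jA).
apply: (sorted_ltn_nth ord_ltn_trans i (sorted_sorted_ords (predC (mem A)))).
- by rewrite inE sizeC ltn_sub2r // (leq_ltn_trans iA).
- by rewrite inE sizeC ltn_sub2r // (leq_ltn_trans jA).
by rewrite ltn_sub2r // (leq_ltn_trans iA).
Qed.

Lemma unshuffle_lt k s : unshuffle k s -> forall i j : 'I_n, (i < j)%N ->
  ((j < k) || (k <= i))%N -> (s i < s j)%N.
Proof.
by move=> us i j ij jk; move/forallP/(_ i)/forallP/(_ j): us; rewrite ij jk.
Qed.

Lemma unshuffle_first k s : unshuffle k s ->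
  map s (sorted_ords (fun i => (i < k)%N)) = sorted_ords (mem (initial_image k s)).
Proof.
move=> us; apply: (irr_sorted_eq ord_ltn_trans) => [i|||i].
- by rewrite /ord_ltn ltnn.
- apply: (homo_sorted_in (P := fun i : 'I_n => (i < k)%N) (e := ord_ltn)).
  + by move=> i j _ jk ij; apply: (unshuffle_lt us ij); rewrite [(j < k)%N]jk.
  + by apply/allP => i; rewrite mem_sorted_ords.
  + exact: sorted_sorted_ords.
- exact: sorted_sorted_ords.
rewrite mem_sorted_ords; apply/mapP/imsetP => -[j jk ->]; exists j => //.
  by rewrite mem_sorted_ords in jk; rewrite inE.
by rewrite inE in jk; rewrite mem_sorted_ords.
Qed.

Lemma unshuffle_last k s : unshuffle k s ->
  map s (sorted_ords (fun i => (k <= i)%N)) =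
  sorted_ords (predC (mem (initial_image k s))).
Proof.
move=> us; apply: (irr_sorted_eq ord_ltn_trans) => [i|||i].
- by rewrite /ord_ltn ltnn.
- apply: (homo_sorted_in (P := fun i : 'I_n => (k <= i)%N) (e := ord_ltn)).
  + by move=> i j ik _ ij; apply: (unshuffle_lt us ij); rewrite [(k <= i)%N]ik orbT.
  + by apply/allP => i; rewrite mem_sorted_ords.
  + exact: sorted_sorted_ords.
- exact: sorted_sorted_ords.
rewrite mem_sorted_ords /=; apply/mapP/idP => [[j jk ->]|nki].
  by rewrite mem_sorted_ords in jk; rewrite mem_imset ?inE -?leqNgt //; apply: perm_inj.
exists (s^-1 i)%g; rewrite ?permKV // mem_sorted_ords leqNgt; apply: contra nki => ik.
by apply/imsetP; exists (s^-1 i)%g; rewrite ?permKV ?inE.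
Qed.

Lemma unshuffleP k s : (k <= n)%N ->
  unshuffle k s =
  (#|initial_image k s| == k) && (unshuffle_of (initial_image k s) == s).
Proof.
move=> le_kn; rewrite card_imset; last exact: perm_inj.
rewrite card_initial // eqxx /=.
apply/idP/eqP => [us|<-]; last first.
  have {1}<- : #|initial_image k s| = k by rewrite card_imset ?card_initial //; apply: perm_inj.
  exact: unshuffle_unshuffle_of.
have splitE : enum 'I_n = sorted_ords (fun i => (i < k)%N) ++ sorted_ords (fun i => (k <= i)%N).
  apply: (irr_sorted_eq ord_ltn_trans) => [i|||i].
  - by rewrite /ord_ltn ltnn.
  - by rewrite -(filter_predT (enum 'I_n)) sorted_sorted_ords.
  - rewrite sorted_pairwise // pairwise_cat -!sorted_pairwise //.
    rewrite !sorted_sorted_ords !andbT; apply/allrelP => i j.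
    by rewrite !mem_sorted_ords; apply: leq_trans.
  - by rewrite mem_cat !mem_sorted_ords mem_enum ltnNge orNb.
apply/permP => i; rewrite permE /unshuffle_fun /unshuffle_seq.
rewrite -(unshuffle_first us) -(unshuffle_last us) -map_cat -splitE.
by rewrite (nth_map i) ?size_enum_ord // nth_ord_enum.
Qed.

(** An unshuffle is increasing on its first [k] indices and on the remaining ones, so
it amounts to the choice of the set of its first [k] values. *)
Lemma sum_unshuffle (V : nmodType) k (H : {set 'I_n} -> V) : (k <= n)%N ->
  \sum_(s : 'S_n | unshuffle k s) H (initial_image k s) =
  \sum_(A : {set 'I_n} | #|A| == k) H A.
Proof.
move=> le_kn; rewrite [RHS](reindex_onto (initial_image k) unshuffle_of) /=.
  by apply: eq_bigl => s; apply: unshuffleP.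
by move=> A /eqP <-; apply: initial_image_unshuffle_of.
Qed.

Lemma sum_all_unshuffles (V : nmodType) (H : {set 'I_n} -> V) :
  \sum_(1 <= k < n.+1) \sum_(s : 'S_n | unshuffle k s) H (initial_image k s) =
  \sum_(A : {set 'I_n} | A != set0) H A.
Proof.
transitivity (\sum_(1 <= k < n.+1) \sum_(A : {set 'I_n} | (A != set0) && (#|A| == k)) H A).
  apply: eq_big_nat => k /andP[k0 kn]; rewrite sum_unshuffle //.
  by apply: eq_bigl => A; case: eqP => [Ak|]; rewrite ?andbF // -card_gt0 Ak k0.
rewrite (exchange_big_dep (fun A => A != set0)) /= => [|k A _ /andP[]//].
apply: eq_bigr => A A0; rewrite (big_rem #|A|) /=; last first.
  rewrite mem_index_iota card_gt0 A0 ltnS.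
  by rewrite -[n in (_ <= n)%N]card_ord max_card.
rewrite A0 eqxx big1_seq ?addr0 // => k /andP[/eqP <-].
by rewrite rem_filter ?iota_uniq // mem_filter /= eqxx.
Qed.
End UnshuffleSets.

(** * Insertions as sums over splittings of the arguments *)
Fixpoint masks (n : nat) : seq bitseq :=
  if n is n'.+1 then map (cons true) (masks n') ++ map (cons false) (masks n')
  else [:: [::]].

Lemma mem_masks n m : (m \in masks n) = (size m == n).
Proof.
elim: n m => [|n IHn] [|[] m] //=; rewrite mem_cat.
- by apply/negbTE/norP; split; apply/mapP => -[].
- rewrite mem_map ?IHn; last by move=> ? ? [].
  by rewrite orbC; case: mapP => [[]|].
rewrite [X in _ || X]mem_map ?IHn; last by move=> ? ? [].
by case: mapP => [[]|].
Qed.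

Lemma uniq_masks n : uniq (masks n).
Proof.
elim: n => //= n IHn; rewrite cat_uniq !map_inj_uniq ?IHn; try by move=> ? ? [].
by rewrite andbT; apply/hasPn => _ /mapP[m _ ->]; apply/mapP => -[].
Qed.

Definition mask_of n (A : {set 'I_n}) : bitseq := [seq i \in A | i <- enum 'I_n].

Lemma nth_mask_of n (A : {set 'I_n}) (i : 'I_n) : nth false (mask_of A) i = (i \in A).
Proof. by rewrite (nth_map i) ?size_enum_ord // nth_ord_enum. Qed.

Lemma size_mask_of n (A : {set 'I_n}) : size (mask_of A) = n.
Proof. by rewrite size_map size_enum_ord. Qed.

(** Bit masks allow recursion on the list of arguments, which subsets of ['I_n] do not. *)
Lemma sum_mask_of (V : nmodType) n (P : pred bitseq) (H : bitseq -> V) :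
  \sum_(A : {set 'I_n} | P (mask_of A)) H (mask_of A) = \sum_(m <- masks n | P m) H m.
Proof.
rewrite -(big_map (@mask_of n) P H); apply: perm_big; apply: uniq_perm.
- rewrite map_inj_uniq ?index_enum_uniq // => A B AB; apply/setP => i.
  by rewrite -!nth_mask_of AB.
- exact: uniq_masks.
move=> m; rewrite mem_masks; apply/mapP/eqP => [[A _ ->]|sm].
  exact: size_mask_of.
exists [set i : 'I_n | nth false m i]; first by rewrite mem_index_enum.
apply: (@eq_from_nth _ false) => [|i]; rewrite sm ?size_mask_of // => i_n.
by rewrite (nth_mask_of _ (Ordinal i_n)) inE.
Qed.

Lemma mask_sorted_ords T n (t : n.-tuple T) (P : pred 'I_n) :
  map (tnth t) (sorted_ords P) = mask (map P (enum 'I_n)) t.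
Proof. by rewrite /sorted_ords filter_mask map_mask map_tnth_enum. Qed.

Section Signs.
Variables (K : fieldType) (T : Type) (f : T -> T -> K).

(** When [f] is the commutation sign, this is the Koszul sign of moving the selected
entries of [X] to the front: each of them passes the unselected ones before it. *)
Fixpoint mask_sign (m : bitseq) (X : seq T) : K :=
  if m is b :: m' then
    if X is x :: X' then
      (if b then 1 else \prod_(y <- mask m' X') f y x) * mask_sign m' X'
    else 1
  else 1.

Lemma prod_mask x0 m X (g : T -> K) : size m = size X ->
  \prod_(i < size X | nth false m i) g (nth x0 X i) = \prod_(y <- mask m X) g y.
Proof.
elim: X m => [|x X IHX] [|b m] //= => [_|[sm]]; first by rewrite big_ord0 big_nil.
rewrite big_mkcond big_ord_recl /= -big_mkcond /= IHX //.
by case: b; rewrite ?big_cons ?mul1r.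
Qed.

Lemma mask_signE x0 m X : size m = size X ->
  \prod_(i < size X | nth false m i)
    \prod_(j < size X | ~~ nth false m j && (j < i)%N) f (nth x0 X i) (nth x0 X j) =
  mask_sign m X.
Proof.
elim: X m => [|x X IHX] [|b m] //= => [_|[sm]]; first by rewrite big_ord0.
rewrite big_mkcond big_ord_recl /= -IHX //.
rewrite [X in (if b then X else _)]big_pred0; last by move=> j; rewrite andbF.
have -> : (if b then 1 else 1) = 1 :> K by case: b.
rewrite mul1r -big_mkcond /=.
under eq_bigr => i _.
  rewrite big_mkcond big_ord_recl /= andbT -big_mkcond /=.
  under eq_bigl do rewrite !ltnS.
  over.
rewrite big_split /=; congr (_ * _).
case: b => /=; first by rewrite big1.
by rewrite (prod_mask x0 (f^~ x)).
Qed.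

End Signs.

Section InsertionSplit.
Variables (K : fieldType) (E : gradedSpace K).
Implicit Types (F G : vform E) (X A B : seq (hvec E)).

Definition comm_sign (x y : hvec E) : K := (-1) ^ (degree x * degree y).

(** The homogeneous vector [F (A)], for [F] of degree [p]. *)
Definition value (p : int) F A : hvec E := hv (F A (total_degree A + p)).

Definition rest (m : bitseq) X := mask (map negb m) X.

(** The inversions of an unshuffle are the pairs formed by a selected entry and an
unselected one before it. *)
Lemma koszul_unshuffle k X (s : 'S_(size X)) : unshuffle k s ->
  koszul s = mask_sign comm_sign (mask_of (initial_image k s)) X.
Proof.
move=> us; case: X s us => [|x0 X'] s us.
  rewrite /koszul big_ord0; case: (mask_of _) => //.
set X := x0 :: X' in s us *; set A := initial_image k s.
rewrite -(mask_signE _ x0) ?size_mask_of // [RHS](reindex_inj (@perm_inj _ s)) /=.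
rewrite [RHS]big_mkcond /=; apply: eq_bigr => i _.
rewrite [X in if _ then X else _](reindex_inj (@perm_inj _ s)) /=.
rewrite nth_mask_of mem_imset; last exact: perm_inj.
rewrite inE.
have inv (j : 'I_(size X)) : ((i < j) && (s j < s i) = [&& i < k, k <= j & s j < s i])%N.
  apply/andP/and3P => [[ij sij]|[ik kj sij]]; last first.
    by split=> //; apply: leq_trans ik kj.
  have : ~~ ((j < k) || (k <= i))%N.
    by apply: contraL sij => ijk; rewrite -leqNgt ltnW // (unshuffle_lt us).
  by rewrite negb_or -leqNgt -ltnNge => /andP[kj ik].
case: ifP => ik; last by rewrite big_pred0 // => j; rewrite inv ik.
apply: eq_big => [j|j _]; last by rewrite /comm_sign !(tnth_nth x0).
by rewrite nth_mask_of mem_imset ?inE ?inv ?ik -?leqNgt //; apply: perm_inj.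
Qed.

Lemma insertion_masks p F G X n :
  insertion p F G X n =
  \sum_(m <- masks (size X) | has id m)
    mask_sign comm_sign m X *: G (value p F (mask m X) :: rest m X) n.
Proof.
pose H m := mask_sign comm_sign m X *: G (value p F (mask m X) :: rest m X) n.
rewrite -(sum_mask_of (size X) (has id) H).
transitivity (\sum_(A : {set 'I_(size X)} | A != set0) H (mask_of A)); last first.
  apply: eq_bigl => A; apply/set0Pn/hasP => [[i iA]|[_ /mapP[i _ ->] iA]]; last by exists i.
  by exists true => //; rewrite -iA; apply: map_f; rewrite mem_enum.
rewrite -sum_all_unshuffles; apply: eq_bigr => k _; apply: eq_bigr => s us.
rewrite /H (koszul_unshuffle us).
have -> : first_args s k = mask (mask_of (initial_image k s)) X.
  rewrite /first_args (map_comp (tnth (in_tuple X)) s).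
  by rewrite -/(sorted_ords (fun i => (i < k)%N)) (unshuffle_first us) mask_sorted_ords.
have -> : last_args s k = rest (mask_of (initial_image k s)) X.
  rewrite /last_args (map_comp (tnth (in_tuple X)) s).
  rewrite -/(sorted_ords (fun i => (k <= i)%N)) (unshuffle_last us) mask_sorted_ords.
  by rewrite /rest /mask_of -map_comp; congr mask.
by [].
Qed.

End InsertionSplit.

(** * Forms on a space concentrated in degrees -2 and -1 *)
Section Multilinear.
Variables (K : fieldType) (E : gradedSpace K).
Implicit Types (F G : vform E) (X A B : seq (hvec E)) (x y z : hvec E).

Lemma total_degree_cons x X : total_degree (x :: X) = degree x + total_degree X.
Proof. exact: big_cons. Qed.

Lemma total_degree_nil : total_degree ([::] : seq (hvec E)) = 0.
Proof. exact: big_nil. Qed.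

Lemma total_degree_cat X Y :
  total_degree (X ++ Y) = total_degree X + total_degree Y.
Proof. exact: big_cat. Qed.

Lemma degree_hv i (v : E i) : degree (hv v) = i.
Proof. by []. Qed.

Lemma degree_value p F A : degree (value p F A) = total_degree A + p.
Proof. by []. Qed.

Lemma vform0 F s t i n : multilinear F -> F (s ++ hv (0 : E i) :: t) n = 0.
Proof.
move=> /(_ s t i 1 0 0 n); rewrite !scale1r addr0 => /eqP.
by rewrite -subr_eq0 opprD addNKr oppr_eq0 => /eqP.
Qed.

Lemma form_hv0 F t i (v : E i) n : multilinear F -> v = 0 -> F (hv v :: t) n = 0.
Proof. by move=> mF ->; apply: (@vform0 F [::]). Qed.

Lemma vformD F t i (v w : E i) n : multilinear F ->
  F (hv (v + w) :: t) n = F (hv v :: t) n + F (hv w :: t) n.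
Proof. by move=> /(_ [::] t i 1 v w n); rewrite !scale1r. Qed.

Lemma vformZ F t i a (v : E i) n : multilinear F ->
  F (hv (a *: v) :: t) n = a *: F (hv v :: t) n.
Proof.
by move=> mF; have := mF [::] t i a v 0 n; rewrite addr0 /= (form_hv0 _ _ mF erefl) addr0.
Qed.

Lemma vformN F t i (v : E i) n : multilinear F ->
  F (hv (- v) :: t) n = - F (hv v :: t) n.
Proof. by move=> mF; rewrite -scaleN1r vformZ // scaleN1r. Qed.

Lemma vformB F t i (v w : E i) n : multilinear F ->
  F (hv (v - w) :: t) n = F (hv v :: t) n - F (hv w :: t) n.
Proof. by move=> mF; rewrite vformD // vformN. Qed.

Lemma form_swap F x y t n : graded_symmetric F ->
  F (x :: y :: t) n = comm_sign x y *: F (y :: x :: t) n.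
Proof. by move=> /(_ [::] t x y n). Qed.

(** Graded symmetry lets one argument travel to the front, so that vanishing can be
tested with it in first position. *)
Lemma form_front F x n : graded_symmetric F ->
  forall s t, F (x :: s ++ t) n = 0 -> F (s ++ x :: t) n = 0.
Proof.
move=> sF s; elim/last_ind: s => //= s y IHs t; rewrite -!cats1 -!catA /= => F0.
by rewrite sF IHs ?scaler0.
Qed.

Lemma component_hv i (v : E i) : component i (hv v) = v.
Proof. exact: (@untagE _ _ _ _ i _ (hv v) erefl). Qed.

Lemma component_neq n x : n != degree x -> component n x = 0.
Proof. by move=> nx; rewrite /component untag_dflt // eq_sym. Qed.

Lemma component_value p F A n : has_degree p F -> component n (value p F A) = F A n.
Proof.
move=> dF; have [->|nA] := eqVneq n (total_degree A + p); first exact: component_hv.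
by rewrite component_neq // dF.
Qed.

Lemma hv_component x : hv (component (degree x) x) = x.
Proof. by case: x => i v; rewrite component_hv. Qed.

End Multilinear.

Section Sparse.
Variables (K : fieldType) (E : gradedSpace K).
Hypothesis sparseE : forall i : int, i != -2 -> i != -1 -> forall x : E i, x = 0.
Implicit Types (F G : vform E) (X A B : seq (hvec E)) (x y z : hvec E).

Definition low (i : int) : bool := (i == -2) || (i == -1).

Lemma lowP i : reflect (i = -2 \/ i = -1) (low i).
Proof. by apply: (iffP orP) => -[] /eqP; [left|right|left|right]. Qed.

Lemma sparse0 i (v : E i) : ~~ low i -> v = 0.
Proof. by rewrite negb_or => /andP[i2 i1]; apply: sparseE. Qed.

Definition low_args X : bool := all (fun x => low (degree x)) X.

(** In a space concentrated in two degrees, a form of degree [d] can only be nonzero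
on the finitely many lists of degrees allowed here.  All identities between forms
are checked only there. *)
Definition supported d F := forall X n,
  F X n = 0 \/ [/\ low_args X, n = total_degree X + d & low n].

Lemma supported0 d F X n : supported d F ->
  (low_args X -> n = total_degree X + d -> low n -> F X n = 0) -> F X n = 0.
Proof. by move=> /(_ X n)[//|[]]; move=> ? ? ? ; apply. Qed.

Lemma supported_sym d F : multilinear F -> has_degree d F -> supported d F.
Proof.
move=> mF dF X n.
case: (boolP (low n)) => [ln|/sparse0 n0]; last by left; apply: n0.
have [nd|nd] := eqVneq n (total_degree X + d); last by left; apply: dF.
case: (boolP (low_args X)) => [lX|/allPn[[i v] Xv /= li]]; first by right.
left; case/splitPr: Xv => s t; rewrite (sparse0 v) //; exact: (@vform0 _ _ F).
Qed.

Lemma low_size X : low_args X -> total_degree X <= - (size X)%:Z.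
Proof.
elim: X => [|x X IHX] /=; first by rewrite total_degree_nil.
by rewrite total_degree_cons => /andP[/lowP lx /IHX]; lia.
Qed.

Lemma total_degree_mask m X : size m = size X ->
  total_degree (mask m X) + total_degree (rest m X) = total_degree X.
Proof.
elim: X m => [|x X IHX] [|[] m] //= => [_|[sm]|[sm]]; rewrite ?total_degree_nil ?addr0 //;
  rewrite /rest /= !total_degree_cons -(IHX m sm).
  by rewrite addrA.
by rewrite addrCA.
Qed.

Lemma low_mask m X : size m = size X ->
  low_args X = low_args (mask m X) && low_args (rest m X).
Proof.
elim: X m => [|x X IHX] [|[] m] //= [sm]; rewrite /rest /= (IHX m sm).
  by rewrite andbA.
by rewrite andbCA.
Qed.

(** If an argument has a forbidden degree, it is either an argument of [F], which makes
the inserted vector zero, or one of [G]. *)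
Lemma supported_insertion p q F G : supported p F -> supported q G ->
  multilinear G -> supported (p + q) (insertion p F G).
Proof.
move=> sF sG mG X n.
case: (boolP (low_args X && ((n == total_degree X + (p + q)) && low n))).
  by case/andP=> lX /andP[/eqP-> ln]; right.
move=> bad; left; rewrite insertion_masks big1_seq // => m /andP[_].
rewrite mem_masks => /eqP sm.
have [->|[/andP[lA lB] nA ln]] := sG (value p F (mask m X) :: rest m X) n; first by rewrite scaler0.
have [FA0|[lm _ _]] := sF (mask m X) (total_degree (mask m X) + p).
  by rewrite (form_hv0 _ _ mG FA0) scaler0.
have {}lB : low_args (rest m X) := lB.
case/negP: bad; rewrite (low_mask sm) lm ln lB andbT /=.
rewrite -(total_degree_mask sm) nA total_degree_cons degree_value; apply/eqP; lia.
Qed.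
End Sparse.

Section SmallInsertions.
Variables (K : fieldType) (E : gradedSpace K).
Variables (p : int) (F G : vform E) (n : int).
Implicit Types (x y z w : hvec E).
Local Notation v A := (value p F A).

Lemma comm_sign_odd x y : degree x = -1 -> degree y = -1 -> comm_sign x y = -1.
Proof. by rewrite /comm_sign => -> ->. Qed.

Lemma insertion1 x : insertion p F G [:: x] n = G [:: v [:: x]] n.
Proof. by rewrite insertion_masks /= !big_cons !big_nil /= mul1r scale1r addr0. Qed.

Lemma insertion2 x y :
  insertion p F G [:: x; y] n =
  G [:: v [:: x; y]] n + G [:: v [:: x]; y] n + comm_sign y x *: G [:: v [:: y]; x] n.
Proof.
rewrite insertion_masks /= !big_cons !big_nil /= /rest /= !big_cons !big_nil.
by rewrite !mulr1 !scale1r addr0 addrA.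
Qed.

(** On arguments of degree -1 a sign is the parity of a number of transpositions;
reading it off from the sizes makes the expansion of an insertion a mere
computation. *)
Fixpoint splits_odd (V : zmodType) X (H : seq (hvec E) -> seq (hvec E) -> V) : V :=
  if X is x :: X' then
    splits_odd X' (fun A B => H (x :: A) B) +
    splits_odd X' (fun A B => if odd (size A) then - H A (x :: B) else H A (x :: B))
  else H [::] [::].

Lemma splits_oddE (V : lmodType K) X (H : seq (hvec E) -> seq (hvec E) -> V) :
  all (fun x => degree x == -1) X ->
  \sum_(m <- masks (size X)) mask_sign (@comm_sign K E) m X *: H (mask m X) (rest m X) =
  splits_odd X H.
Proof.
elim: X H => [|x X IHX] H /=; first by rewrite big_seq1 scale1r.
case/andP=> /eqP dx dX; rewrite big_cat !big_map -!IHX //=; congr (_ + _).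
  by apply: eq_bigr => m _; rewrite mul1r.
rewrite !big_seq; apply: eq_bigr => m; rewrite mem_masks => /eqP sm.
have -> : \prod_(y <- mask m X) comm_sign y x = (-1) ^+ size (mask m X).
  have : all (fun x => degree x == -1) (mask m X) by apply: all_mask.
  elim: (mask m X) => [|y Y IHY] /=; first by rewrite big_nil.
  by case/andP => /eqP dy dY; rewrite big_cons comm_sign_odd // IHY // exprS.
rewrite -signr_odd mulrC -scalerA; by case: odd; rewrite ?(expr1, expr0, scaleN1r, scale1r).
Qed.

Lemma insertion_odd X : all (fun x => degree x == -1) X ->
  insertion p F G X n =
  splits_odd X (fun A B => if A is [::] then 0 else G (v A :: B) n).
Proof.
move=> dX; rewrite -splits_oddE // insertion_masks big_mkcond /= !big_seq.
apply: eq_bigr => m; rewrite mem_masks => /eqP sm.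
have -> : has id m = (mask m X != [::]).
  by elim: m X sm {dX} => [|[] m IHm] [|x X] //= [sm]; apply: IHm.
by case: (mask m X) => [|y Y]; rewrite ?scaler0.
Qed.

Lemma insertion3_odd x y z : degree x = -1 -> degree y = -1 -> degree z = -1 ->
  insertion p F G [:: x; y; z] n =
  (G [:: v [:: x]; y; z] n - G [:: v [:: y]; x; z] n + G [:: v [:: z]; x; y] n) +
  (G [:: v [:: x; y]; z] n - G [:: v [:: x; z]; y] n + G [:: v [:: y; z]; x] n) +
  G [:: v [:: x; y; z]] n.
Proof.
by move=> dx dy dz; rewrite insertion_odd /= ?dx ?dy ?dz //; zmod.
Qed.

Lemma insertion4_odd x y z w :
  degree x = -1 -> degree y = -1 -> degree z = -1 -> degree w = -1 ->
  insertion p F G [:: x; y; z; w] n =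
  (G [:: v [:: x]; y; z; w] n - G [:: v [:: y]; x; z; w] n
   + G [:: v [:: z]; x; y; w] n - G [:: v [:: w]; x; y; z] n) +
  (G [:: v [:: x; y]; z; w] n - G [:: v [:: x; z]; y; w] n + G [:: v [:: x; w]; y; z] n
   + G [:: v [:: y; z]; x; w] n - G [:: v [:: y; w]; x; z] n + G [:: v [:: z; w]; x; y] n) +
  (G [:: v [:: x; y; z]; w] n - G [:: v [:: x; y; w]; z] n
   + G [:: v [:: x; z; w]; y] n - G [:: v [:: y; z; w]; x] n) +
  G [:: v [:: x; y; z; w]] n.
Proof.
by move=> dx dy dz dw; rewrite insertion_odd /= ?dx ?dy ?dz ?dw //; zmod.
Qed.
End SmallInsertions.

(** * The bracket with the Euler map plus a 2-form *)
Section Composites.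
Variables (K : fieldType) (E : gradedSpace K).
Implicit Types (F G : vform E) (X A B : seq (hvec E)) (x y z : hvec E).

Lemma comp_multilinear p F G s s' t i (a : K) (v w : E i) n :
  multilinear F -> multilinear G ->
  G (value p F (s ++ hv (a *: v + w) :: s') :: t) n =
  a *: G (value p F (s ++ hv v :: s') :: t) n + G (value p F (s ++ hv w :: s') :: t) n.
Proof.
move=> mF mG; rewrite /value !total_degree_cat !total_degree_cons !degree_hv mF.
exact: (mG [::]).
Qed.

(** The two inserted vectors have the same degree only propositionally, which is why
they are compared as dependent pairs. *)
Lemma comp_swap p F G x y s t n : graded_symmetric F -> multilinear G ->
  G (value p F (x :: y :: s) :: t) n =
  comm_sign x y *: G (value p F (y :: x :: s) :: t) n.
Proof.
move=> sF mG; rewrite /value form_swap // vformZ // !total_degree_cons.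
by rewrite addrCA.
Qed.

Lemma value_eq p F G A : (forall n, F A n = G A n) -> value p F A = value p G A.
Proof. by move=> FG; rewrite /value FG. Qed.

Lemma comp0 p F G A t n : multilinear G -> (forall n, F A n = 0) ->
  G (value p F A :: t) n = 0.
Proof. by move=> mG FA0; apply: form_hv0. Qed.

Lemma comm_signC x y : comm_sign x y = comm_sign y x.
Proof. by rewrite /comm_sign mulrC. Qed.

Lemma sym_form_add d F G : sym_form d F -> sym_form d G -> sym_form d (vform_add F G).
Proof.
move=> [mF sF dF F0] [mG sG dG G0]; split; rewrite /vform_add.
- by move=> s t i a v w n; rewrite mF mG scalerDr addrACA.
- by move=> s t x y n; rewrite sF sG scalerDr.
- by move=> X n Xn; rewrite dF ?dG ?addr0.
by move=> n; rewrite F0 G0 addr0.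
Qed.

Lemma sym_form_euler : sym_form 0 (euler E).
Proof.
split=> //.
- move=> [|x [|y s]] [|z t] i a v w n; rewrite /= ?scaler0 ?addr0 //.
  have -> : component n (hv (a *: v + w)) = a *: component n (hv v) + component n (hv w).
    have [->|ni] := eqVneq n i; first by rewrite !component_hv.
    by rewrite !component_neq ?scaler0 ?addr0.
  by rewrite scalerDr !scalerA mulrC.
- by move=> [|x [|x' s]] t y z n; rewrite /= ?scaler0.
- move=> [|x [|y X]] n //=; rewrite total_degree_cons total_degree_nil !addr0 => nx.
  by rewrite component_neq ?scaler0.
Qed.

End Composites.

Section EulerPlus.
Variables (K : fieldType) (E : gradedSpace K) (a : vform E).
Hypothesis a2 : sym_kform 2 0 a.
Implicit Types (F G : vform E) (X A B : seq (hvec E)) (x y z : hvec E).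

Local Notation N := (vform_add (euler E) a).

Lemma sym_form_euler_plus : sym_form 0 N.
Proof. by apply: sym_form_add; [apply: sym_form_euler|case: a2]. Qed.

Lemma euler_plus1 x n : N [:: x] n = (- degree x)%:~R *: component n x.
Proof. by rewrite /vform_add (a2.2 [:: x]) // addr0. Qed.

Lemma euler_plus2 x y n : N [:: x; y] n = a [:: x; y] n.
Proof. exact: add0r. Qed.

Lemma euler_plus3 x y z t n : N [:: x, y, z & t] n = 0.
Proof. by rewrite /vform_add a2.2 ?addr0. Qed.

(** The Euler map multiplies by minus the degree. *)
Lemma comp_euler_plus1 G x t n : multilinear G ->
  G (value 0 N [:: x] :: t) n = (- degree x)%:~R *: G (x :: t) n.
Proof.
move=> mG; rewrite /value euler_plus1 vformZ //.
by rewrite total_degree_cons total_degree_nil !addr0 hv_component.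
Qed.

Lemma euler_plus_value p F A n : has_degree p F ->
  N [:: value p F A] n = (- (total_degree A + p))%:~R *: F A n.
Proof. by move=> dF; rewrite euler_plus1 component_value. Qed.

End EulerPlus.

Section Deformation.
Variables (K : fieldType) (E : gradedSpace K).
Hypothesis sparseE : forall i : int, i != -2 -> i != -1 -> forall x : E i, x = 0.
Implicit Types (F G : vform E) (X A B : seq (hvec E)) (x y z : hvec E).

(** For a Lie 2-algebra this says that chi is zero.  For a form of
degree 1 it holds automatically in arity at least 3, by degree. *)
Definition flat F := forall X n,
  (1 < size X)%N -> has (fun x => degree x == -2) X -> F X n = 0.

Lemma flat_first F x t n : flat F -> (0 < size t)%N -> degree x = -2 -> F (x :: t) n = 0.
Proof. by move=> fF t0 dx; apply: fF => //=; rewrite dx eqxx. Qed.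

Lemma sym_supported d F : sym_form d F -> supported d F.
Proof. by case=> mF _ dF _; apply: supported_sym. Qed.

Lemma supported1_eq F G : supported 1 F -> supported 1 G ->
  (forall x n, F [:: x] n = G [:: x] n) ->
  (forall x y n, F [:: x; y] n = G [:: x; y] n) ->
  (forall x y z n, degree x = -1 -> degree y = -1 -> degree z = -1 ->
     F [:: x; y; z] n = G [:: x; y; z] n) ->
  F = G.
Proof.
move=> sF sG e1 e2 e3; apply/functional_extensionality_dep => X.
apply/functional_extensionality_dep => n.
have main : low_args X -> n = total_degree X + 1 -> low n -> F X n = G X n.
  case: X => [|x [|y [|z [|w X]]]] // lX nX /lowP ln.
  - by move: nX; rewrite total_degree_nil; lia.
  - move: lX nX; rewrite /= !total_degree_cons total_degree_nil.
    case/and4P => /lowP lx /lowP ly /lowP lz _ nX.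
    by apply: e3; lia.
  - by have := low_size lX; move: nX => /=; lia.
case: (sF X n) => [F0|[*]]; last exact: main.
by case: (sG X n) => [G0|[*]]; [rewrite F0 G0|exact: main].
Qed.

Section Deform.
Variables (mu a : vform E).
Hypotheses (muS : sym_form 1 mu) (mu_flat : flat mu) (a2 : sym_kform 2 0 a).
Local Notation m A := (value 1 mu A).

Let muM : multilinear mu. Proof. by case: muS. Qed.
Let muC : graded_symmetric mu. Proof. by case: muS. Qed.
Let muD : has_degree 1 mu. Proof. by case: muS. Qed.
Let aM : multilinear a. Proof. by case: a2 => -[]. Qed.
Let aC : graded_symmetric a. Proof. by case: a2 => -[]. Qed.
Let aD : has_degree 0 a. Proof. by case: a2 => -[]. Qed.
Let muP := sym_supported muS.
Let aP := sym_supported a2.1.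

(** The insertion of [l_2] in [a] on three vectors of degree -1, where all Koszul
signs are known.  In the other degrees it is zero and so is the insertion. *)
Definition cyclic_comp x y z n :=
  a [:: m [:: x; y]; z] n - a [:: m [:: x; z]; y] n + a [:: m [:: y; z]; x] n.

(** The bracket of [a] with [mu], when [a] vanishes on the image of [l_1].  The
remaining terms of that bracket are zero by degree or by [flat]. *)
Definition correction : vform E := fun X n =>
  match X with
  | [:: x; y] => mu [:: value 0 a [:: x; y]] n
  | [:: x; y; z] => - cyclic_comp x y z n
  | _ => 0
  end.

Definition deform : vform E := vform_add mu correction.

Lemma deform1 x n : deform [:: x] n = mu [:: x] n.
Proof. exact: addr0. Qed.

Lemma comp_odd x y z n :
  a [:: m [:: x; y]; z] n = 0 \/ [/\ degree x = -1, degree y = -1 & degree z = -1].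
Proof.
case: (muP [:: x; y] (total_degree [:: x; y] + 1)) => [mxy|[lxy _ _]].
  by left; apply: form_hv0.
case: (aP [:: m [:: x; y]; z] n) => [->|[lz nE /lowP ln]]; first by left.
right; move: lxy lz nE; rewrite /= !total_degree_cons total_degree_nil degree_value.
rewrite !total_degree_cons total_degree_nil.
by move=> /and3P[/lowP lx /lowP ly _] /and3P[/lowP lxy /lowP lz _] nE; split; lia.
Qed.

Lemma cyclic_comp0 x y z n :
  ~ [/\ degree x = -1, degree y = -1 & degree z = -1] -> cyclic_comp x y z n = 0.
Proof.
move=> nodd; rewrite /cyclic_comp.
case: (comp_odd x y z n) => [->|//].
case: (comp_odd x z y n) => [->|[] //]; last by move=> *; case: nodd.
case: (comp_odd y z x n) => [->|[] //]; last by move=> *; case: nodd.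
by rewrite subr0 addr0.
Qed.

Lemma comp_swap_odd x y z n : degree x = -1 -> degree y = -1 ->
  a [:: m [:: x; y]; z] n = - a [:: m [:: y; x]; z] n.
Proof. by move=> dx dy; rewrite comp_swap // comm_sign_odd // scaleN1r. Qed.

Lemma cyclic_comp_swap12 x y z n :
  cyclic_comp x y z n = comm_sign x y *: cyclic_comp y x z n.
Proof.
case: (boolP [&& degree x == -1, degree y == -1 & degree z == -1]).
  case/and3P=> /eqP dx /eqP dy /eqP dz; rewrite comm_sign_odd // scaleN1r.
  rewrite /cyclic_comp (comp_swap_odd _ _ dx dy); zmod.
move=> nodd; rewrite !cyclic_comp0 ?scaler0 //;
  by case=> dx dy dz; case/negP: nodd; rewrite dx dy dz eqxx.
Qed.

Lemma cyclic_comp_swap23 x y z n :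
  cyclic_comp x y z n = comm_sign y z *: cyclic_comp x z y n.
Proof.
case: (boolP [&& degree x == -1, degree y == -1 & degree z == -1]).
  case/and3P=> /eqP dx /eqP dy /eqP dz; rewrite comm_sign_odd // scaleN1r.
  rewrite /cyclic_comp (comp_swap_odd _ _ dy dz); zmod.
move=> nodd; rewrite !cyclic_comp0 ?scaler0 //;
  by case=> dx dy dz; case/negP: nodd; rewrite dx dy dz eqxx.
Qed.

(** Linearity is only needed in the first place: the other places follow by symmetry. *)
Lemma cyclic_comp_linear1 i b (v w : E i) y z n :
  cyclic_comp (hv (b *: v + w)) y z n =
  b *: cyclic_comp (hv v) y z n + cyclic_comp (hv w) y z n.
Proof.
have am y' z' := comp_multilinear 1 [::] [:: y'] [:: z'] b v w n muM aM.
have := @aM [:: m [:: y; z]] [::] _ b v w n; rewrite /= in am * => am'.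
rewrite /cyclic_comp !am am'.
rewrite !scalerDr scalerN; zmod.
Qed.

Lemma sym_form_correction : sym_form 1 correction.
Proof.
split=> //.
- move=> s t i b v w n.
  have lin2 x z : cyclic_comp x (hv (b *: v + w)) z n =
      b *: cyclic_comp x (hv v) z n + cyclic_comp x (hv w) z n.
    rewrite !(cyclic_comp_swap12 x) cyclic_comp_linear1 scalerDr !scalerA.
    by rewrite (mulrC b).
  have lin3 x y : cyclic_comp x y (hv (b *: v + w)) n =
      b *: cyclic_comp x y (hv v) n + cyclic_comp x y (hv w) n.
    rewrite !(cyclic_comp_swap23 x y) lin2 scalerDr !scalerA.
    by rewrite (mulrC b).
  move: s t => [|x [|y [|z s]]] [|x' [|y' [|z' t]]] //=;
    try by case: s => [|? ?] /=; rewrite scaler0 addr0.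
  all: rewrite ?(scaler0, addr0) //.
  + exact: (comp_multilinear 0 [::] [:: x'] [::] b v w n aM muM).
  + by rewrite cyclic_comp_linear1 scalerN opprD.
  + exact: (comp_multilinear 0 [:: x] [::] [::] b v w n aM muM).
  + by rewrite lin2 scalerN opprD.
  + by rewrite lin3 scalerN opprD.
- move=> s t x y n; move: s t => [|u [|u' s]] [|v [|v' t]] //=; rewrite ?scaler0 //.
  + exact: comp_swap.
  + by rewrite cyclic_comp_swap12 scalerN.
  + by rewrite cyclic_comp_swap23 scalerN.
  + by case: s => [|? [|? s]] /=; rewrite ?scaler0.
  + by case: s => [|? [|? s]] /=; rewrite ?scaler0.
  + by case: s => [|? [|? s]] /=; rewrite ?scaler0.
move=> [|x [|y [|z [|w X]]]] n //=; rewrite !total_degree_cons total_degree_nil => nX.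
  apply: muD; rewrite !total_degree_cons degree_value !total_degree_cons total_degree_nil.
  by apply: contraNneq nX => ->; apply/eqP; lia.
have a0 x' y' z' : degree x' + (degree y' + degree z') = degree x + (degree y + degree z) ->
    a [:: m [:: x'; y']; z'] n = 0.
  move=> e; apply: aD; rewrite !total_degree_cons degree_value !total_degree_cons total_degree_nil.
  by apply: contraNneq nX => ->; apply/eqP; lia.
by rewrite /cyclic_comp !a0 ?(subr0, addr0, oppr0) //; lia.
Qed.

Lemma sym_form_deform : sym_form 1 deform.
Proof. by apply: sym_form_add => //; apply: sym_form_correction. Qed.

Lemma flat_deform : flat deform.
Proof.
move=> X n sX evX; rewrite /deform /vform_add mu_flat // add0r.
case: X sX evX => [|x [|y [|z [|w X]]]] //= _ evX.
  apply: form_hv0 => //.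
  case: (aP [:: x; y] (total_degree [:: x; y] + 0)) => [//|[lX _ /lowP ln]]; exfalso; move: ln.
  move: lX; rewrite /= !total_degree_cons total_degree_nil => /and3P[/lowP lx /lowP ly _].
  by move: evX; rewrite orbF => /orP[] /eqP; lia.
rewrite cyclic_comp0 ?oppr0 // => -[dx dy dz].
by move: evX; rewrite dx dy dz.
Qed.

Hypothesis a_exact : forall x y n, a [:: m [:: x]; y] n = 0.

Local Notation N := (vform_add (euler E) a).

(** The bracket with the Euler map is multiplication by the degree, here 1, so it
reproduces [mu]; only the bracket with [a] changes it. *)
Lemma bracket_euler_plus : rn_bracket 0 1 N mu = deform.
Proof.
have NS := sym_form_euler_plus a2.
have NM : multilinear N by case: NS.
apply: supported1_eq.
- have s1 : supported 1 (insertion 0 N mu).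
    rewrite -[X in supported X]add0r; apply: supported_insertion => //; exact: sym_supported.
  have s2 : supported 1 (insertion 1 mu N).
    rewrite -[X in supported X]addr0; apply: supported_insertion => //; exact: sym_supported.
  move=> X n; rewrite /rn_bracket.
  case: (s1 X n) => [->|]; last by right.
  by case: (s2 X n) => [->|]; [left; rewrite scaler0 subr0|right].
- exact: sym_supported sym_form_deform.
all: rewrite /rn_bracket mul0r expr0z.
- move=> x n; rewrite !insertion1 scale1r deform1 comp_euler_plus1 // euler_plus_value //.
  rewrite total_degree_cons total_degree_nil -scalerBl -rmorphB /=.
  by rewrite (_ : _ - _ = 1) ?scale1r //; ring.
- move=> x y n; rewrite !insertion2 scale1r.
  rewrite !comp_euler_plus1 // euler_plus_value // !euler_plus2 // !a_exact scaler0 !addr0.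
  rewrite (value_eq _ (fun k => euler_plus2 a x y k)).
  rewrite scalerA mulrC -scalerA comm_signC -(muC [::] [::] x y) /=.
  rewrite !total_degree_cons total_degree_nil /deform /vform_add /=.
  have cancel (p q r : K) (V : lmodType K) (w u : V) : p + q - r = 1 ->
      u + p *: w + q *: w - r *: w = w + u.
    by move=> pqr; rewrite -!addrA -scalerBl -scalerDl addrA pqr scale1r addrC.
  by apply: cancel; ring.
move=> x y z n dx dy dz; rewrite !insertion3_odd // scale1r.
have va : [/\ degree (value 0 N [:: x; y]) = -2, degree (value 0 N [:: x; z]) = -2
            & degree (value 0 N [:: y; z]) = -2].
  by rewrite !degree_value !total_degree_cons total_degree_nil dx dy dz.
case: va => vxy vxz vyz.
rewrite !comp_euler_plus1 // !euler_plus3 // !euler_plus2 // euler_plus_value //.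
rewrite (flat_first _ mu_flat _ vxy) // (flat_first _ mu_flat _ vxz) //.
rewrite (flat_first _ mu_flat _ vyz) //.
rewrite (comp0 _ _ _ muM (fun k => euler_plus3 a2 x y z [::] k)).
have e1 : mu [:: y; x; z] n = - mu [:: x; y; z] n.
  by rewrite form_swap // comm_sign_odd // scaleN1r.
have e2 : mu [:: z; x; y] n = mu [:: x; y; z] n.
  rewrite form_swap // (muC [:: x] [::] z y) /= -/(comm_sign z y).
  by rewrite !comm_sign_odd // !scaleN1r opprK.
rewrite e1 e2 !total_degree_cons total_degree_nil dx dy dz.
have -> : (- (-1 + (-1 + (-1 + 0)) + 1))%:~R = 1 + 1 :> K by ring.
have -> : (- (-1))%:~R = 1 :> K by ring.
rewrite scalerDl !scale1r /deform /vform_add /= /cyclic_comp; zmod.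
Qed.

Lemma deform_exact x y n : a [:: value 1 deform [:: x]; y] n = 0.
Proof. by rewrite (value_eq _ (deform1 x)). Qed.

End Deform.

Variables (mu a : vform E).
Hypotheses (muS : sym_form 1 mu) (mu_flat : flat mu) (a2 : sym_kform 2 0 a).
Hypothesis a_exact : forall x y n, a [:: value 1 mu [:: x]; y] n = 0.

Lemma sym_kform_double : sym_kform 2 0 (vform_add a a).
Proof.
case: a2 => aS a0; split; first exact: sym_form_add.
by move=> X n sX; rewrite /vform_add a0 ?addr0.
Qed.

(** In arity 2 the correction is exact, so that [a] does not see it; hence the second deformation adds the same correction as the first. *)
Lemma deform_twice : deform (deform mu a) a = deform mu (vform_add a a).
Proof.
have [muM _ _ _] := muS; have [[aM _ _ _] _] := a2.
apply/functional_extensionality_dep => X; apply/functional_extensionality_dep => n.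
rewrite [LHS]/deform [RHS]/deform /vform_add.
case: X => [|x [|y [|z [|w X]]]]; rewrite /= /deform /vform_add /= ?addr0 //.
  rewrite /value vformD // addrA; done.
have nest x' y' z' : a [:: value 1 (deform mu a) [:: x'; y']; z'] n =
    a [:: value 1 mu [:: x'; y']; z'] n.
  rewrite /value {1}/deform /vform_add /= vformD // -[RHS]addr0; congr (_ + _).
  have := a_exact (value 0 a [:: x'; y']) z' n.
  by rewrite {1}/value total_degree_cons degree_value total_degree_nil !addr0.
rewrite /cyclic_comp !nest; zmod.
Qed.

Local Notation N := (vform_add (euler E) a).
Local Notation L := (vform_add (euler E) (vform_add a a)).

(** The witness is [S + 2 a]: it commutes with [S + a] because [S] commutes with [a],
and its bracket with [mu] is the double bracket by [deform_twice]. *)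
Lemma nijenhuis_euler_plus : nijenhuis mu N.
Proof.
have [aS _] := a2; have NS := sym_form_euler_plus a2.
have a2' := sym_kform_double; have LS := sym_form_euler_plus a2'.
have NM : multilinear N by case: NS.
have LM : multilinear L by case: LS.
have ND : has_degree 0 N by case: NS.
have LD : has_degree 0 L by case: LS.
split=> //; exists L => //; split=> X n.
  rewrite !bracket_euler_plus ?deform_twice //.
  - by move=> x y k; rewrite /vform_add a_exact addr0.
  - exact: sym_form_deform.
  - exact: flat_deform.
  - exact: deform_exact.
rewrite /rn_bracket mul0r expr0z scale1r.
have supp F G : sym_form 0 F -> sym_form 0 G -> supported 0 (insertion 0 F G).
  by move=> FS GS; rewrite -[X in supported X]addr0; apply: supported_insertion;
    [exact: sym_supported|exact: sym_supported|case: GS].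
have main : low_args X -> n = total_degree X + 0 -> low n ->
    insertion 0 N L X n - insertion 0 L N X n = 0.
  case: X => [|x [|y [|z X]]] lX nX /lowP ln.
  - by move: nX; rewrite total_degree_nil; lia.
  - rewrite !insertion1 !comp_euler_plus1 // !euler_plus1 // subrr //.
  - rewrite !insertion2 !comp_euler_plus1 // !euler_plus_value // !euler_plus2 //.
    rewrite !total_degree_cons total_degree_nil.
    rewrite !scalerA !(mulrC (comm_sign y x)) -!scalerA comm_signC.
    have <- : vform_add a a [:: x; y] n = comm_sign x y *: vform_add a a [:: y; x] n.
      by rewrite [LHS]form_swap //; case: a2'.1.
    rewrite -[comm_sign x y *: _](form_swap x y [::] n) //; last by case: aS.
    have -> : (- (degree x + (degree y + 0) + 0))%:~R =
              (- degree x)%:~R + (- degree y)%:~R :> K by ring.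
    rewrite /vform_add !scalerDl !scalerDr; apply/eqP; rewrite subr_eq0; apply/eqP.
    zmod.
  - have := low_size lX; rewrite [size _]/=; lia.
case: (supp _ _ NS LS X n) => [NL0|[*]]; last exact: main.
by case: (supp _ _ LS NS X n) => [LN0|[*]]; [rewrite NL0 LN0 subr0|exact: main].
Qed.

End Deformation.

(** * Generalized inverses of linear maps *)
Section GeneralizedInverse.
Variable K : fieldType.

Definition lin_closed (V : lmodType K) (A : V -> Prop) :=
  forall (a : K) x y, A x -> A y -> A (a *: x + y).

(** A subspace [Q] that is maximal among those meeting [P] only in zero is a complement
of [P], since otherwise it could be enlarged by a vector outside [P + Q].  The empty
set is admitted as [Q] in Zorn's lemma because it is the union of the empty chain. *)
Lemma complement (V : lmodType K) (P : V -> Prop) : P 0 -> lin_closed P ->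
  exists Q : V -> Prop, [/\ Q 0, lin_closed Q, forall x, P x -> Q x -> x = 0
    & forall x, exists2 q, Q q & P (x - q)].
Proof.
move=> P0 lP.
pose indep (A : V -> Prop) := lin_closed A /\ forall x, P x -> A x -> x = 0.
have [F FI totF|Q [[lQ PQ] maxQ]] := @classical_sets.Zorn_bigcup V indep.
  split=> [a x y [A FA Ax] [B FB By]|x Px [A FA Ax]]; last exact: (FI A FA).2 x Px Ax.
  have [AB|BA] := totF A B FA FB.
    by exists B => //; apply: (FI B FB).1 => //; apply: AB.
  by exists A => //; apply: (FI A FA).1 => //; apply: BA.
have sumclosed z : lin_closed (fun x => exists q b, (Q q \/ q = 0) /\ x = q + b *: z).
  move=> a _ _ [q [b [Qq ->]]] [r [c [Qr ->]]]; exists (a *: q + r), (a * b + c); split.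
    case: Qq Qr => [Qq|->] [Qr|->]; rewrite ?scaler0 ?add0r ?addr0; last 1 first.
    - by right.
    - by left; apply: (lQ).
    - left; rewrite -[_ *: _]addr0; apply: (lQ) => //.
      by rewrite -(subrr q) -scaleN1r addrC; apply: (lQ).
    - by left.
  by rewrite scalerDr scalerDl scalerA addrACA.
have grow z : ~ Q z -> exists x b, [/\ P x, x <> 0 & exists2 q, Q q \/ q = 0 & x = q + b *: z].
  move=> nQz; pose B : V -> Prop := fun x => exists q b, (Q q \/ q = 0) /\ x = q + b *: z.
  apply: contrapT => none; apply: (maxQ B).
    split; last first.
      by move=> BQ; apply: nQz; apply: BQ; exists 0, 1; split; [right|rewrite add0r scale1r].
    by move=> x Qx; exists x, 0; split; [left|rewrite scale0r addr0].
  split=> [|x Px [q [b [Qq xE]]]]; first exact: sumclosed.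
  by apply: contrapT => x0; apply: none; exists x, b; split=> //; exists q.
have Q0 : Q 0.
  apply: contrapT => nQ0; have [x [b [_ x0 [q [Qq|->] xE]]]] := grow 0 nQ0.
    by apply: nQ0; rewrite -(subrr q) -scaleN1r addrC; apply: (lQ).
  by apply: x0; rewrite xE scaler0 addr0.
exists Q; split=> // z.
have [Qz|nQz] := pselect (Q z); first by exists z; rewrite ?subrr.
(* A nonzero vector [x] of [P] in [Q + K z] involves [z], so [z] lies in [P + Q]. *)
have [x [b [Px x0 [q Qq' xE]]]] := grow z nQz.
have Qq : Q q by case: Qq' => [//|->].
have b0 : b != 0.
  apply/eqP => b0; apply: x0; apply: PQ => //.
  by rewrite xE b0 scale0r addr0.
exists (- (b^-1 *: q)).
  by rewrite -[- _]addr0 -scaleNr; apply: (lQ).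
rewrite opprK -[X in P X]addr0.
suff -> : z + b^-1 *: q = b^-1 *: x by apply: lP.
by rewrite xE scalerDr scalerA mulVf // scale1r addrC.
Qed.

Lemma linear_ex (V W : lmodType K) (g : V -> W) : linear g ->
  exists g' : {linear V -> W}, g' =1 g.
Proof.
move=> lg; pose m := GRing.isLinear.Build K V W _ g lg.
by pose g' : {linear V -> W} := HB.pack g m; exists g'.
Qed.

(** The map [f] is an isomorphism from a complement [Q] of its kernel onto its image.
Invert it there and extend by zero on a complement [C] of the image. *)
Lemma generalized_inverse (V W : lmodType K) (f : {linear V -> W}) :
  exists g : {linear W -> V},
    (forall x, f (g (f x)) = f x) /\ (forall y, g (f (g y)) = g y).
Proof.
have [|a x y|Q [Q0 lQ kerQ decQ]] := @complement V (fun x => f x = 0).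
- exact: linear0.
- by rewrite linearP /= => -> ->; rewrite scaler0 addr0.
have [|a _ _ [x ->] [y ->]|C [C0 lC imC decC]] := @complement W (fun y => exists x, y = f x).
- by exists 0; rewrite linear0.
- by exists (a *: x + y); rewrite linearP.
have lift y : exists q, Q q /\ C (y - f q).
  have [c Cc [x yc]] := decC y; have [q Qq] := decQ x.
  rewrite linearB => /eqP; rewrite subr_eq0 => /eqP fxq.
  by exists q; split=> //; rewrite -fxq -yc opprB addrC subrK.
have [g gP] := choice lift.
have uniq y q : Q q -> C (y - f q) -> g y = q.
  move=> Qq Cq; have [Qg Cg] := gP y.
  apply/eqP; rewrite -subr_eq0; apply/eqP; apply: kerQ.
    apply: imC; first by exists (g y - q).
    suff -> : f (g y - q) = -1 *: (y - f (g y)) + (y - f q) by apply: lC.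
    by rewrite linearB scaleN1r opprB addrA subrK.
  by rewrite addrC -scaleN1r; apply: (lQ).
have lg : linear g.
  move=> a x y; apply: uniq; first by apply: (lQ); [apply: (gP x).1|apply: (gP y).1].
  suff -> : a *: x + y - f (a *: g x + g y) = a *: (x - f (g x)) + (y - f (g y)).
    by apply: lC; [apply: (gP x).2|apply: (gP y).2].
  by rewrite linearP opprD addrACA scalerBr.
have gfQ q : Q q -> g (f q) = q by move=> Qq; apply: uniq => //; rewrite subrr.
have [g' g'E] := linear_ex lg; exists g'; split=> [x|y]; rewrite !g'E.
  have [Qg Cg] := gP (f x).
  apply/eqP; rewrite eq_sym -subr_eq0; apply/eqP; apply: imC => //.
  by exists (x - g (f x)); rewrite linearB.
exact: gfQ (gP y).1.
Qed.

End GeneralizedInverse.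

(** * Restriction of a bracket to the image of a projection *)
Section FixedSubspace.
Variables (K : fieldType) (V : lmodType K) (p : {linear V -> V}).

Definition fixed_pred : {pred V} := [pred v | p v == v].

Lemma fixed_submod : submod_closed fixed_pred.
Proof.
split=> [|c u v]; first by rewrite inE linear0.
by rewrite !inE linearP => /eqP-> /eqP->.
Qed.

HB.instance Definition _ := GRing.isSubmodClosed.Build K V fixed_pred fixed_submod.

Record fixed := Fixed { fixed_val :> V; _ : fixed_val \in fixed_pred }.
HB.instance Definition _ := [isSub for fixed_val].
HB.instance Definition _ := [Choice of fixed by <:].
HB.instance Definition _ := [SubChoice_isSubLmodule of fixed by <:].
End FixedSubspace.

Section Restriction.
Variables (K : fieldType) (E : gradedSpace K).
Variables (p : forall n, {linear E n -> E n}).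
Hypothesis pK : forall n v, p n (p n v) = p n v.

Definition fixed_space : gradedSpace K := fun n => fixed (p n).
Definition incl n : {linear fixed_space n -> E n} := \val.
Definition retr n (v : E n) : fixed_space n := Fixed (introT eqP (pK v)).

Lemma incl_retr n v : incl n (retr v) = p n v.
Proof. by []. Qed.

Lemma incl_inj n : injective (incl n).
Proof. exact: val_inj. Qed.

Lemma incl_fixed n u : p n (incl n u) = incl n u.
Proof. by case: u => v /= /eqP. Qed.

Variable nu : vform E.

Definition restrict : vform fixed_space := fun X n => retr (nu (map (hmap incl) X) n).

Lemma total_degree_hmap (E' : gradedSpace K) (j : forall i, {linear E' i -> E i}) X :
  total_degree (map (hmap j) X) = total_degree X.
Proof. by rewrite /total_degree big_map. Qed.

Lemma incl_restrict X n :
  incl n (restrict X n) = p n (nu (map (hmap incl) X) n).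
Proof. by []. Qed.

Lemma sym_form_restrict d : sym_form d nu -> sym_form d restrict.
Proof.
case=> nuM nuC nuD nu0; split.
- move=> s t i a v w n; apply: incl_inj; rewrite linearP !incl_restrict !map_cat /=.
  have -> : hmap incl (hv (a *: v + w)) = hv (a *: incl i v + incl i w).
    by congr (hv _); exact: (linearP (incl i)).
  by rewrite nuM linearP.
- move=> s t x y n; apply: incl_inj; rewrite linearZ /= !map_cat /=.
  by rewrite nuC linearZ.
- move=> X n nX; apply: incl_inj; rewrite incl_restrict linear0 nuD ?linear0 //.
  by rewrite total_degree_hmap.
by move=> n; apply: incl_inj; rewrite incl_restrict nu0 !linear0.
Qed.

Lemma mask_sign_map (T T' : Type) (f : T' -> T' -> K) (g : T -> T') m X :
  mask_sign f m (map g X) = mask_sign (fun x y => f (g x) (g y)) m X.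
Proof.
elim: m X => [|b m IHm] [|x X] //=; rewrite IHm -map_mask big_map.
by [].
Qed.

Hypothesis nu_closed : forall X n,
  p n (nu (map (hmap incl) X) n) = nu (map (hmap incl) X) n.

(** When the restricted bracket has its values in the fixed subspace, restricting
commutes with composing, so that structure equations are inherited. *)
Lemma incl_insertion q X n :
  incl n (insertion q restrict restrict X n) =
  insertion q nu nu (map (hmap incl) X) n.
Proof.
rewrite !insertion_masks size_map linear_sum; apply: eq_bigr => m _.
rewrite linearZ mask_sign_map; congr (_ *: _).
rewrite incl_restrict nu_closed map_cons /rest map_mask; congr (nu (_ :: _) n).
rewrite -map_mask /value total_degree_hmap; congr (hv _); exact: nu_closed.
Qed.

Lemma lie2_restrict :
  (forall i : int, i != -2 -> i != -1 -> forall x : E i, x = 0) ->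
  sym_form 1 nu -> (forall X n, insertion 1 nu nu X n = 0) -> lie2_algebra restrict.
Proof.
move=> sparseE nuS nunu; split.
  by move=> i i2 i1 x; apply: incl_inj; rewrite linear0; apply: sparseE.
split=> [|X n]; first exact: sym_form_restrict.
rewrite /rn_bracket (_ : insertion 1 _ _ X n = 0) ?scaler0 ?subr0 //.
by apply: incl_inj; rewrite incl_insertion nunu linear0.
Qed.

End Restriction.

(** * Splitting off the trivial part *)
Section Exact.
Variables (K : fieldType) (E : gradedSpace K).
Hypothesis sparseE : forall i : int, i != -2 -> i != -1 -> forall x : E i, x = 0.
Variable mu : vform E.
Hypotheses (muS : sym_form 1 mu) (mu_flat : flat mu).
Hypothesis jacobi : forall X n, insertion 1 mu mu X n = 0.
Implicit Types (x y z w : hvec E).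
Local Notation m A := (value 1 mu A).

Let muM : multilinear mu. Proof. by case: muS. Qed.
Let muC : graded_symmetric mu. Proof. by case: muS. Qed.
Let muD : has_degree 1 mu. Proof. by case: muS. Qed.
Let muP : supported 1 mu. Proof. exact: sym_supported. Qed.

(** With an argument [x] of degree -2, any term in which [x] sits next to another
argument vanishes by flatness; the only term left is the one where [l_1] is applied
to [x] alone. *)
Lemma insertion_even_first x t n : degree x = -2 -> t != [::] ->
  insertion 1 mu mu (x :: t) n = mu (m [:: x] :: t) n.
Proof.
move=> dx t0; rewrite insertion_masks /= big_cat !big_map /=.
rewrite [X in _ + X]big1_seq ?addr0 => [|b /andP[_]]; last first.
  rewrite mem_masks => /eqP sb; rewrite mu_flat ?scaler0 //=.
  by rewrite /rest /= dx eqxx orbT.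
rewrite (bigD1_seq (nseq (size t) false)) ?uniq_masks ?mem_masks ?size_nseq //=.
rewrite big1_seq ?addr0 => [|b /andP[b0]]; last first.
  rewrite mem_masks => /eqP sb; rewrite mul1r.
  have -> : mu (m (x :: mask b t) :: rest (true :: b) (x :: t)) n = 0; last by rewrite scaler0.
  apply: comp0 => // k; apply: mu_flat; last by rewrite /= dx eqxx.
  rewrite /= ltnS lt0n size_eq0; apply: contra b0 => /eqP bt.
  by elim: b t sb bt {t0} => [|[] b IHb] [|y t] //= [sb] bt; rewrite (eqP (IHb t sb bt)).
rewrite mul1r mask_false /rest /= map_nseq /=.
have -> : mask (nseq (size t) true) t = t by apply: mask_true.
suff -> : mask_sign (@comm_sign K E) (nseq (size t) false) t = 1 by rewrite scale1r.
by elim: t {t0} => //= y t ->; rewrite mask_false big_nil mulr1.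
Qed.

(** Only [l_1] of a vector of degree -2 can be nonzero, and then the structure equation
on that vector followed by [t] has no other term. *)
Lemma exact_args x k t n : t != [::] -> mu (hv (mu [:: x] k) :: t) n = 0.
Proof.
move=> t0.
case: (muP [:: x] k) => [e|[lx kE /lowP lk]]; first exact: form_hv0.
move: lx kE; rewrite /= total_degree_cons total_degree_nil andbT addr0 => /lowP lx kE.
have dx : degree x = -2 by lia.
have -> : hv (mu [:: x] k) = m [:: x].
  by rewrite /value total_degree_cons total_degree_nil addr0 kE.
by rewrite -insertion_even_first.
Qed.

Lemma degree_pair p F x y : degree x = -1 -> degree y = -1 ->
  degree (value p F [:: x; y]) = -2 + p.
Proof. by move=> dx dy; rewrite degree_value !total_degree_cons total_degree_nil dx dy. Qed.

Lemma degree_triple p F x y z : degree x = -1 -> degree y = -1 -> degree z = -1 ->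
  degree (value p F [:: x; y; z]) = -3 + p.
Proof.
by move=> dx dy dz; rewrite degree_value !total_degree_cons total_degree_nil dx dy dz.
Qed.

Lemma jacobi3 x y z n : degree x = -1 -> degree y = -1 -> degree z = -1 ->
  mu [:: m [:: x; y]; z] n - mu [:: m [:: x; z]; y] n + mu [:: m [:: y; z]; x] n
  = - mu [:: m [:: x; y; z]] n.
Proof.
move=> dx dy dz; have := jacobi [:: x; y; z] n.
rewrite insertion3_odd // !exact_args // subr0 addr0 add0r.
by move/eqP; rewrite addr_eq0 => /eqP.
Qed.

Lemma jacobi4 x y z w n :
  degree x = -1 -> degree y = -1 -> degree z = -1 -> degree w = -1 ->
  mu [:: m [:: x; y]; z; w] n - mu [:: m [:: x; z]; y; w] n
  + mu [:: m [:: x; w]; y; z] n + mu [:: m [:: y; z]; x; w] n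
  - mu [:: m [:: y; w]; x; z] n + mu [:: m [:: z; w]; x; y] n = 0.
Proof.
move=> dx dy dz dw; have := jacobi [:: x; y; z; w] n.
have tri a b c d : degree a = -1 -> degree b = -1 -> degree c = -1 ->
    mu [:: m [:: a; b; c]; d] n = 0.
  by move=> da db dc; apply: flat_first => //; rewrite degree_triple.
rewrite insertion4_odd // !exact_args // !tri //.
rewrite (_ : mu [:: m [:: x; y; z; w]] n = 0); first by rewrite !(subr0, addr0, add0r).
apply: comp0 => // k; apply: (supported0 muP) => lX -> /lowP.
by have := low_size lX; rewrite [size _]/=; lia.
Qed.

(** A generalized inverse is given for each pair of degrees, although [l_1] maps [E_n]
to [E_k] only when [k = n + 1], so as to avoid transport along equations between
degrees. *)
Variable h : forall k n, {linear E k -> E n}.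
Hypothesis mu_h_mu : forall n k (v : E n), mu [:: hv (h k n (mu [:: hv v] k))] k = mu [:: hv v] k.
Hypothesis h_mu_h : forall n k (v : E k), h k n (mu [:: hv (h k n v)] k) = h k n v.

(** The identity [h l_1 h = h] forces [h] to be zero wherever [l_1] is. *)
Lemma h_cases k n (v : E k) : h k n v = 0 \/ k = -1 /\ n = -2.
Proof.
case: (muP [:: hv (h k n v)] k) => [e|[]].
  by left; rewrite -h_mu_h e linear0.
rewrite /= total_degree_cons total_degree_nil degree_hv andbT => /lowP ln kE /lowP lk.
by right; split; lia.
Qed.

Lemma mu_mu k n x : mu [:: hv (mu [:: x] k)] n = 0.
Proof.
apply: (supported0 muP); rewrite /= total_degree_cons total_degree_nil degree_hv andbT.
move=> /lowP lk nE /lowP ln; apply: form_hv0 => //; apply: (supported0 muP).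
by rewrite /= total_degree_cons total_degree_nil => /andP[/lowP lx _] kE _; lia.
Qed.

Definition alpha : vform E := fun X n =>
  if size X == 2 then - h (n + 1) n (mu X (n + 1)) else 0.

Lemma alpha_sym : sym_kform 2 0 alpha.
Proof.
split; last by move=> X n; rewrite /alpha => /negbTE ->.
split=> //.
- move=> s t i a v w n; rewrite /alpha !size_cat /=.
  case: eqP => _; last by rewrite scaler0 addr0.
  by rewrite muM linearP opprD scalerN.
- move=> s t x y n; rewrite /alpha !size_cat /=.
  case: eqP => _; last by rewrite scaler0.
  by rewrite muC linearZ scalerN.
- move=> X n nX; rewrite /alpha; case: eqP => // _.
  rewrite muD ?linear0 ?oppr0 //; apply: contraNneq nX => e; apply/eqP; lia.
Qed.

Let aM : multilinear alpha. Proof. by case: alpha_sym => -[]. Qed.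
Let aC : graded_symmetric alpha. Proof. by case: alpha_sym => -[]. Qed.

Lemma alpha_exact x k y n : alpha [:: hv (mu [:: x] k); y] n = 0.
Proof. by rewrite /alpha /= exact_args // linear0 oppr0. Qed.

Lemma alpha_exact_r x k y n : alpha [:: y; hv (mu [:: x] k)] n = 0.
Proof. by rewrite form_swap // alpha_exact scaler0. Qed.

(** The projection onto the image of [l_1]. *)
Definition dh n (v : E n) : E n := mu [:: hv (h n (n - 1) v)] n.

Lemma dhD n (u v : E n) : dh (u + v) = dh u + dh v.
Proof. by rewrite /dh linearD vformD. Qed.

Lemma dhN n (v : E n) : dh (- v) = - dh v.
Proof. by rewrite /dh linearN vformN. Qed.

Lemma dh_mu x n : dh (mu [:: x] n) = mu [:: x] n.
Proof.
case: x => i v; rewrite /dh -[existT _ _ _]/(hv v).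
have [e|ni] := eqVneq i (n - 1); last first.
  have -> : mu [:: hv v] n = 0; last by rewrite linear0 form_hv0.
  apply: muD; rewrite total_degree_cons total_degree_nil degree_hv addr0.
  by apply: contraNneq ni => ->; apply/eqP; lia.
by subst i; apply: mu_h_mu.
Qed.

Lemma dh_dh n (v : E n) : dh (dh v) = dh v.
Proof. exact: dh_mu. Qed.

Lemma mu_alpha x y n : mu [:: value 0 alpha [:: x; y]] n = - dh (mu [:: x; y] n).
Proof.
rewrite /value /alpha /=; set k := _ + 0.
have [->|nk] := eqVneq n (k + 1).
  by rewrite vformN // /dh addrK.
have -> : mu [:: x; y] n = 0.
  by apply: muD; apply: contraNneq nk => ->; apply/eqP; rewrite /k; lia.
rewrite /dh linear0 [mu [:: hv 0] n]form_hv0 // oppr0; apply: muD.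
by rewrite total_degree_cons total_degree_nil addr0 degree_hv.
Qed.

Definition nu := deform mu alpha.

Let nuS : sym_form 1 nu. Proof. exact: sym_form_deform alpha_sym. Qed.
Let nu_flat : flat nu. Proof. exact: flat_deform alpha_sym. Qed.
Let nuM : multilinear nu. Proof. by case: nuS. Qed.
Let nuC : graded_symmetric nu. Proof. by case: nuS. Qed.
Let nuP : supported 1 nu. Proof. exact: sym_supported. Qed.

Lemma nu1 x n : nu [:: x] n = mu [:: x] n.
Proof. exact: deform1. Qed.

Lemma nu2 x y n : nu [:: x; y] n = mu [:: x; y] n - dh (mu [:: x; y] n).
Proof. by rewrite -mu_alpha. Qed.

Lemma nu3 x y z n : nu [:: x; y; z] n = mu [:: x; y; z] n - cyclic_comp mu alpha x y z n.
Proof. by []. Qed.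

Lemma nu_exact_first x k t n : t != [::] -> nu (hv (mu [:: x] k) :: t) n = 0.
Proof.
case: t => [|y [|z [|w t]]] // _.
- by rewrite nu2 exact_args // /dh linear0 form_hv0 // subr0.
- rewrite nu3 exact_args // /cyclic_comp alpha_exact_r.
  have zero u v : alpha [:: m [:: hv (mu [:: x] k); u]; v] n = 0.
    by apply: comp0 => // l; apply: exact_args.
  by rewrite !zero !(subr0, addr0).
by rewrite /nu /deform /vform_add exact_args // addr0.
Qed.

Lemma nu_exact x k s t n : (0 < size s + size t)%N -> nu (s ++ hv (mu [:: x] k) :: t) n = 0.
Proof.
move=> st; apply: form_front => //; apply: nu_exact_first.
by rewrite -size_eq0 size_cat -lt0n.
Qed.

(** The bracket [nu (x, y)] differs from [l_2 (x, y)] by an exact term, which the outer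
bracket kills. *)
Lemma nu_nested x y t n : t != [::] ->
  nu (value 1 nu [:: x; y] :: t) n = nu (m [:: x; y] :: t) n.
Proof.
move=> t0; rewrite /value nu2 vformB // [X in _ - X](_ : _ = 0) ?subr0 //.
by rewrite nu_exact_first.
Qed.

(** Applying [l_1] to the correction gives [d h] of the Jacobiator of [l_2], that is,
[- d h d l_3 = - d l_3], which cancels [d l_3]. *)
Lemma nu_cocycle x y z k n : degree x = -1 -> degree y = -1 -> degree z = -1 ->
  mu [:: hv (nu [:: x; y; z] k)] n = 0.
Proof.
move=> dx dy dz; apply: (supported0 muP).
rewrite /= total_degree_cons total_degree_nil degree_hv addr0 => _ nE _.
have [kE|nk] := eqVneq k (total_degree [:: x; y; z] + 1); last first.
  by apply: form_hv0 => //; case: nuS => _ _ + _; apply.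
have nested u v w : mu [:: hv (alpha [:: m [:: u; v]; w] k)] n = - dh (mu [:: m [:: u; v]; w] n).
  by rewrite nE /dh addrK /alpha /= vformN.
rewrite nu3 vformB // vformD // vformB // !nested -!dhN -!dhD opprK.
have -> : - mu [:: m [:: x; y]; z] n + mu [:: m [:: x; z]; y] n
          + - mu [:: m [:: y; z]; x] n = mu [:: m [:: x; y; z]] n.
  by rewrite -[RHS]opprK -jacobi3 //; zmod.
by rewrite dh_mu /value -kE subrr.
Qed.

Lemma nu_mu3 u y z n :
  nu [:: u; y; z] n = mu [:: u; y; z] n -
  (alpha [:: m [:: u; y]; z] n - alpha [:: m [:: u; z]; y] n + alpha [:: m [:: y; z]; u] n).
Proof. by []. Qed.

(** The Jacobiator of [l_2] is exact, hence invisible to [alpha]. *)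
Lemma alpha_jacobi x y z w n : degree x = -1 -> degree y = -1 -> degree z = -1 ->
  alpha [:: m [:: m [:: x; y]; z]; w] n - alpha [:: m [:: m [:: x; z]; y]; w] n
  + alpha [:: m [:: m [:: y; z]; x]; w] n = 0.
Proof.
move=> dx dy dz.
have pair u v t : degree u = -1 -> degree v = -1 -> degree t = -1 ->
    m [:: m [:: u; v]; t] = hv (mu [:: m [:: u; v]; t] (-1)).
  move=> du dv dt; rewrite {1}/value (_ : _ + 1 = -1) //.
  by rewrite !total_degree_cons total_degree_nil degree_pair // dt.
rewrite !pair // -vformB // -vformD // jacobi3 // vformN //.
by rewrite alpha_exact oppr0.
Qed.

(** The Jacobiator of [(1 - d h) l_2] is [1 - d h] applied to the exact vector
[- d l_3], hence zero; and [nu] composed with its 3-form is zero by [nu_cocycle]. *)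
Lemma nu_jacobi3 x y z n : degree x = -1 -> degree y = -1 -> degree z = -1 ->
  insertion 1 nu nu [:: x; y; z] n = 0.
Proof.
move=> dx dy dz; rewrite insertion3_odd //.
have single u v t : nu [:: value 1 nu [:: u]; v; t] n = 0.
  by rewrite /value nu1 nu_exact_first.
rewrite !single !nu_nested // [nu [:: value 1 nu _] n]nu1 nu_cocycle // !nu2.
have e := jacobi3 n dx dy dz.
have : dh (mu [:: m [:: x; y]; z] n) - dh (mu [:: m [:: x; z]; y] n)
       + dh (mu [:: m [:: y; z]; x] n) = - mu [:: m [:: x; y; z]] n.
  by rewrite -dhN -!dhD e dhN dh_mu.
rewrite -e => {}e.
transitivity ((mu [:: m [:: x; y]; z] n - mu [:: m [:: x; z]; y] n + mu [:: m [:: y; z]; x] n)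
   - (dh (mu [:: m [:: x; y]; z] n) - dh (mu [:: m [:: x; z]; y] n)
       + dh (mu [:: m [:: y; z]; x] n))); first by zmod.
by rewrite e subrr.
Qed.

(** Inserting [l_2] in the correction gives four sums as in [alpha_jacobi], one for each
argument left outside, and the terms [alpha (l_2 (x, y), l_2 (z, w))], which cancel
in pairs by antisymmetry. *)
Lemma nu_jacobi4 x y z w n :
  degree x = -1 -> degree y = -1 -> degree z = -1 -> degree w = -1 ->
  insertion 1 nu nu [:: x; y; z; w] n = 0.
Proof.
move=> dx dy dz dw.
have single u v t s : nu [:: value 1 nu [:: u]; v; t; s] n = 0.
  by rewrite /value nu1 nu_exact_first.
have tri a b c d : degree a = -1 -> degree b = -1 -> degree c = -1 ->
    nu [:: value 1 nu [:: a; b; c]; d] n = 0.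
  by move=> da db dc; apply: flat_first => //; rewrite degree_triple.
have quad : nu [:: value 1 nu [:: x; y; z; w]] n = 0.
  apply: comp0 => // k; apply: (supported0 nuP) => lX -> /lowP.
  by have := low_size lX; rewrite [size _]/=; lia.
rewrite insertion4_odd // !single !tri // quad !nu_nested // !nu_mu3.
have swap a b c d : degree a = -1 -> degree b = -1 -> degree c = -1 -> degree d = -1 ->
    alpha [:: m [:: a; b]; m [:: c; d]] n = - alpha [:: m [:: c; d]; m [:: a; b]] n.
  by move=> da db dc dd; rewrite form_swap // comm_sign_odd ?scaleN1r // degree_pair.
have j4 := jacobi4 n dx dy dz dw.
have jw := alpha_jacobi w n dx dy dz.
have jz := alpha_jacobi z n dx dy dw.
have jy := alpha_jacobi y n dx dz dw.
have jx := alpha_jacobi x n dy dz dw.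
rewrite (swap z w) // (swap y w) // (swap y z) //.
(* The sum of all terms is the one of [jacobi4] corrected by the four Jacobiators,
   each inserted in [alpha] next to the remaining argument. *)
match type of j4 with ?a = _ => match type of jw with ?b = _ =>
match type of jz with ?c = _ => match type of jy with ?d = _ => match type of jx with ?e = _ =>
  transitivity (a - b + c - d + e) end end end end end; last first.
  by rewrite j4 jw jz jy jx !(subr0, addr0).
zmod.
Qed.

Lemma nu_jacobi X n : insertion 1 nu nu X n = 0.
Proof.
have supp : supported 2 (insertion 1 nu nu).
  by rewrite -[2]/(1 + 1); apply: supported_insertion.
apply: (supported0 supp) => lX nX /lowP ln.
have [oX|] := boolP (all (fun x => degree x == -1) X); last first.
  move=> /allPn[x Xx nx]; have dx : degree x = -2.
    by case/lowP: (allP lX x Xx) => // e; rewrite e eqxx in nx.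
  have s1 : (1 < size X)%N.
    case: X Xx lX nX {nx} => [|y [|z X]] //=.
    rewrite inE total_degree_cons total_degree_nil => /eqP<-.
    by rewrite dx; lia.
  have evX Y : x \in Y -> has (fun x => degree x == -2) Y.
    by move=> Yx; apply/hasP; exists x => //; rewrite dx.
  rewrite insertion_masks big1_seq // => b /andP[b0]; rewrite mem_masks => /eqP sb.
  rewrite (_ : nu _ n = 0) ?scaler0 //.
  have : (x \in mask b X) || (x \in rest b X).
    have sbX : size b = size X by [].
    elim: X b {lX nX s1 b0 sb} sbX Xx => [|y X IHX] [|[] b] //= [sb];
      rewrite inE /rest /= inE => /orP[->|/(IHX b sb)]; rewrite ?orbT //.
      by rewrite -orbA => ->; rewrite orbT.
    by rewrite orbCA => ->; rewrite orbT.
  case/orP=> Yx; last first.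
    apply: nu_flat; last by rewrite /= evX ?orbT.
    by rewrite /= ltnS; case: (rest b X) Yx.
  case mE : (mask b X) Yx => [|y [|z Y]] // Yx; last first.
    by apply: comp0 => // k; apply: nu_flat => //; apply: evX.
  rewrite /value nu1; apply: nu_exact_first; apply/eqP => r0.
  have sizes : (size (mask b X) + size (rest b X))%N = size X.
    by rewrite !size_mask ?size_map // count_map (count_predC id b).
  by move: s1; rewrite -sizes mE r0.
have tX : total_degree X = - (size X)%:Z.
  elim: X {lX nX} oX => [|x X IHX] /=; first by rewrite total_degree_nil.
  by rewrite total_degree_cons => /andP[/eqP -> /IHX ->]; lia.
move: nX ln oX; rewrite tX; case: X {lX tX} => [|x [|y [|z [|w [|v X]]]]] /=; try lia.
  by move=> _ _ /and4P[/eqP dx /eqP dy /eqP dz _]; apply: nu_jacobi3.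
by move=> _ _ /and5P[/eqP dx /eqP dy /eqP dz /eqP dw _]; apply: nu_jacobi4.
Qed.

Lemma tproj_linear n : linear (fun v : E n => h (n + 1) n (mu [:: hv v] (n + 1)) + dh v).
Proof.
move=> a u v; rewrite (muM [::] [::]) linearP /dh linearP (muM [::] [::]).
by rewrite scalerDr addrACA.
Qed.

(** The map [h d + d h], as a bundled linear map. *)
Variable tproj : forall n, {linear E n -> E n}.
Hypothesis tprojE : forall n (v : E n),
  tproj n v = h (n + 1) n (mu [:: hv v] (n + 1)) + dh v.

Lemma h_eq0 k n (v : E k) : ~ (k = -1 /\ n = -2) -> h k n v = 0.
Proof. by case: (h_cases n v). Qed.

Lemma tproj_mu x n : tproj n (mu [:: x] n) = mu [:: x] n.
Proof. by rewrite tprojE mu_mu linear0 add0r dh_mu. Qed.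

Lemma tproj_h k n (v : E k) : tproj n (h k n v) = h k n v.
Proof.
case: (h_cases n v) => [->|[kE nE]]; first by rewrite linear0.
have dh0 : dh (h k n v) = 0 by apply: form_hv0 => //; apply: h_eq0; lia.
rewrite tprojE dh0 addr0.
have {}kE : k = n + 1 by rewrite kE nE.
by subst k; rewrite h_mu_h.
Qed.

Lemma tprojK n v : tproj n (tproj n v) = tproj n v.
Proof. by rewrite [X in tproj n X]tprojE linearD tproj_h /dh tproj_mu tprojE. Qed.

Lemma mu_tproj n (v : E n) k : mu [:: hv (tproj n v)] k = mu [:: hv v] k.
Proof.
rewrite tprojE vformD // /dh mu_mu addr0.
have [->|nk] := eqVneq k (n + 1); first exact: mu_h_mu.
have zero (u : E n) : mu [:: hv u] k = 0.
  by apply: muD; rewrite total_degree_cons total_degree_nil addr0.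
by rewrite !zero.
Qed.

(** A vector of the trivial part is in degree -2, where flatness applies, or in the image
of [l_1]. *)
Lemma nu_tproj s t n (v : E n) k : (0 < size s + size t)%N ->
  tproj n v = v -> nu (s ++ hv v :: t) k = 0.
Proof.
move=> st <-; rewrite tprojE.
rewrite -[h _ _ _]scale1r nuM nu_exact // addr0 scale1r.
have [->|[_ nE]] := h_cases n (mu [:: hv v] (n + 1)); first exact: vform0.
apply: nu_flat; last by rewrite has_cat /= nE eqxx orbT.
by rewrite size_cat /= addnS ltnS.
Qed.

(** In arity 1 the vector [x] has no component in the trivial part, hence [l_1 x] is
zero; in arity 2, [d h (1 - d h) = 0]; in arity 3 this is [nu_cocycle]. *)
Lemma tproj_nu X n : (forall x, x \in X -> tproj (tag x) (tagged x) = 0) ->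
  tproj n (nu X n) = 0.
Proof.
case: X => [|x [|y [|z [|w X]]]] sX.
- by case: nuS => _ _ _ ->; rewrite linear0.
- rewrite nu1 (_ : mu [:: x] n = 0) ?linear0 //.
  have := sX x (mem_head _ _); case: x {sX} => i v /= v0.
  by rewrite -[existT _ _ _]/(hv v) -mu_tproj v0 form_hv0.
- have [->|[lX nE /lowP ln]] := nuP [:: x; y] n; first by rewrite linear0.
  have [ev|odd] := boolP (has (fun x => degree x == -2) [:: x; y]).
    by rewrite nu_flat // linear0.
  move: lX odd nE; rewrite /= !total_degree_cons total_degree_nil.
  move=> /and3P[/lowP lx /lowP ly _] odd nE.
  have n1 : n = -1 by lia.
  rewrite tprojE (h_eq0 (n := n)) ?add0r; last by lia.
  by rewrite nu2 dhD dhN dh_dh subrr.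
- have [->|[lX nE /lowP ln]] := nuP [:: x; y; z] n; first by rewrite linear0.
  move: lX nE; rewrite /= !total_degree_cons total_degree_nil.
  move=> /and4P[/lowP lx /lowP ly /lowP lz _] nE.
  rewrite tprojE nu_cocycle; try by lia.
  by rewrite linear0 add0r /dh h_eq0 ?form_hv0 //; lia.
rewrite (_ : nu _ n = 0) ?linear0 //; apply: (supported0 nuP) => lX nE /lowP.
by have := low_size lX; move: nE; rewrite [size _]/=; lia.
Qed.

Definition sproj n : {linear E n -> E n} := idfun \- tproj n.

Lemma sprojE n v : sproj n v = v - tproj n v.
Proof. by []. Qed.

Lemma sprojK n v : sproj n (sproj n v) = sproj n v.
Proof. by rewrite !sprojE linearB tprojK subrr subr0. Qed.

Let stringE := fixed_space sproj.
Let trivialE := fixed_space tproj.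
Let js n : {linear stringE n -> E n} := incl sproj n.
Let jt n : {linear trivialE n -> E n} := incl tproj n.

Lemma string_tproj n (u : stringE n) : tproj n (js n u) = 0.
Proof.
have := incl_fixed u; rewrite -/(js n u) sprojE => /eqP.
by rewrite subr_eq addrC -subr_eq subrr eq_sym => /eqP.
Qed.

Lemma string_closed X n :
  sproj n (nu (map (hmap js) X) n) = nu (map (hmap js) X) n.
Proof.
rewrite sprojE tproj_nu ?subr0 // => _ /mapP[x _ ->].
exact: string_tproj.
Qed.

Lemma trivial_closed X n :
  tproj n (nu (map (hmap jt) X) n) = nu (map (hmap jt) X) n.
Proof.
case: X => [|x [|y X]].
- by case: nuS => _ _ _ ->; rewrite linear0.
- by rewrite nu1 tproj_mu.
rewrite (nu_tproj (s := [::])) ?linear0 //; exact: incl_fixed.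
Qed.

Lemma split_direct_sum :
  direct_sum nu (restrict sprojK nu) (restrict tprojK nu).
Proof.
exists js, jt; split=> [n|X n|X n|X n].
- exists (fun v => (retr sprojK v, retr tprojK v)) => [[u v]|v].
    rewrite -[(u, v).1]/u -[(u, v).2]/v.
    congr (_, _); apply: incl_inj; rewrite incl_retr.
      rewrite sprojE linearD string_tproj add0r.
      by rewrite [tproj n _]incl_fixed addrK.
    by rewrite linearD string_tproj add0r incl_fixed.
  by rewrite /js /jt !incl_retr sprojE subrK.
- by rewrite incl_restrict string_closed.
- by rewrite incl_restrict trivial_closed.
move=> hasl /hasP[[//|y] Xy _].
case/splitPr: Xy hasl => s t hasl; rewrite map_cat /=.
apply: nu_tproj; last exact: incl_fixed.
rewrite !size_map; case: s t hasl => [|? s] [|? t] //.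
Qed.

Lemma string_part : string_lie_algebra (restrict sprojK nu).
Proof.
split=> [|x n].
  by apply: lie2_restrict => //; [apply: string_closed|apply: nu_jacobi].
apply: incl_inj; rewrite incl_restrict string_closed linear0 nu1.
case: x => i u; rewrite -[hmap js _]/(hv (js i u)).
by rewrite -mu_tproj string_tproj form_hv0.
Qed.

(** The inverse of [l_1 : E_(-2) -> E_(-1)] on the trivial part is induced by [h]. *)
Lemma trivial_part : trivial_lie2_algebra (restrict tprojK nu).
Proof.
split.
- by apply: lie2_restrict => //; [apply: trivial_closed|apply: nu_jacobi].
- move=> X n sX; apply: incl_inj; rewrite incl_restrict linear0.
  rewrite [nu _ n](_ : _ = 0) ?linear0 //.
  case: X sX => [|x X] sX; first by case: sX.
  apply: (nu_tproj (s := [::])); last exact: incl_fixed.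
  by rewrite size_map; case: sX => /= -[->].
exists (fun y : trivialE (-1) => retr tprojK (h (-1) (-2) (jt (-1) y))) => [f|y].
  apply: incl_inj; rewrite incl_retr tproj_h.
  rewrite -[jt (-1) _]/(tproj (-1) (nu [:: hv (jt (-2) f)] (-1))) nu1 tproj_mu.
  have dh0 : dh (jt (-2) f) = 0 by apply: form_hv0 => //; apply: h_eq0 => -[].
  by have := incl_fixed f; rewrite tprojE dh0 addr0.
apply: incl_inj; rewrite incl_restrict.
rewrite -[map _ _]/[:: hv (tproj (-2) (h (-1) (-2) (jt (-1) y)))] nu1 tproj_h tproj_mu.
have := incl_fixed y; rewrite tprojE (@h_eq0 (-1 + 1) (-1)) ?add0r //; by case.
Qed.

Lemma exists_splitting :
  exists (Es Et : gradedSpace K) (mus : vform Es) (mut : vform Et),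
    [/\ string_lie_algebra mus, trivial_lie2_algebra mut & direct_sum nu mus mut].
Proof.
exists stringE, trivialE, (restrict sprojK nu), (restrict tprojK nu).
by split; [apply: string_part|apply: trivial_part|apply: split_direct_sum].
Qed.

End Exact.

(** * The theorem *)
Lemma scalars_two_neq0 (R : realType) (b : base_field) : 2%:R != 0 :> scalars R b.
Proof. by case: b; rewrite pnatr_eq0. Qed.

(** The bracket of a form of degree 1 with itself is twice its self-insertion. *)
Lemma bracket_self (K : fieldType) (E : gradedSpace K) (mu : vform E) :
  2%:R != 0 :> K -> (forall X n, rn_bracket 1 1 mu mu X n = 0) ->
  forall X n, insertion 1 mu mu X n = 0.
Proof.
move=> two0 mumu X n; have := mumu X n.
rewrite /rn_bracket mulr1 expr1z scaleN1r opprK -mulr2n -scaler_nat => /eqP.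
by rewrite scaler_eq0 (negbTE two0) => /eqP.
Qed.

(** Three or more arguments of degrees -1 and -2 with at least one of degree -2 have a total
degree too low for a bracket of degree 1 to be nonzero. *)
Lemma flat_chi0 (K : fieldType) (E : gradedSpace K) (mu : vform E) :
  (forall i : int, i != -2 -> i != -1 -> forall x : E i, x = 0) ->
  sym_form 1 mu ->
  (forall (x : E (-1)) (f : E (-2)) n, mu [:: hv x; hv f] n = 0) -> flat mu.
Proof.
move=> sparseE muS chi0 X n sX evX; have [_ muC _ _] := muS.
apply: (supported0 (sym_supported sparseE muS)) => lX nX /lowP ln.
have even_size : total_degree X <= - (size X)%:Z - 1.
  have /hasP[x Xx /eqP dx] := evX; case/splitPr: Xx lX => s t.
  (* The argument [x] of degree -2 lowers the total degree by one more. *)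
  rewrite /low_args all_cat /= => /and3P[/low_size ls _ /low_size lt].
  by rewrite total_degree_cat total_degree_cons size_cat /= dx; lia.
case: X sX evX lX nX even_size => [|x [|y [|z X]]] //= _; last by move=> *; lia.
rewrite !orbF => evX /and3P[/lowP lx /lowP ly _].
rewrite !total_degree_cons total_degree_nil => nX _.
have chi0' u v : degree u = -1 -> degree v = -2 -> mu [:: u; v] n = 0.
  by case: u v => [i u] [j v]; rewrite /degree /= => iE jE; subst i j; apply: chi0.
case/orP: evX => /eqP dx; last by apply: chi0' => //; lia.
by rewrite form_swap // chi0' ?scaler0 //; lia.
Qed.

Theorem proposition2p5p25 (R : realType) (b : base_field)
    (E : gradedSpace (scalars R b)) (l1 l2 l3 : vform E)
    (hl1 : sym_kform 1 1 l1) (hl2 : sym_kform 2 1 l2) (hl3 : sym_kform 3 1 l3)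
    (hmu : lie2_algebra (vform_add (vform_add l1 l2) l3))
    (hchi : forall (x : E (-1)) (f : E (-2)) (n : int),
        l2 [:: hv x; hv f] n = 0) :
  exists alpha : vform E,
    [/\ sym_kform 2 0 alpha,
        nijenhuis (vform_add (vform_add l1 l2) l3) (vform_add (euler E) alpha)
      & exists (Es Et : gradedSpace (scalars R b))
               (mus : vform Es) (mut : vform Et),
          [/\ string_lie_algebra mus,
              trivial_lie2_algebra mut
            & direct_sum
                (rn_bracket 0 1 (vform_add (euler E) alpha)
                   (vform_add (vform_add l1 l2) l3))
                mus mut]].
Proof.
set mu := vform_add (vform_add l1 l2) l3 in hmu *.
have [sparseE [muS mumu]] := hmu.
have jacobi := bracket_self (scalars_two_neq0 R b) mumu.
have mu_flat : flat mu.
  apply: flat_chi0 => // x f n.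
  by rewrite /mu /vform_add hl1.2 // hl3.2 // hchi !addr0.
have muM : multilinear mu by case: muS.
have [h hP] : exists h : forall k n, {linear E k -> E n}, forall n k,
    (forall v : E n, mu [:: hv (h k n (mu [:: hv v] k))] k = mu [:: hv v] k) /\
    (forall v : E k, h k n (mu [:: hv (h k n v)] k) = h k n v).
  have ex k n : exists g : {linear E k -> E n},
      (forall v : E n, mu [:: hv (g (mu [:: hv v] k))] k = mu [:: hv v] k) /\
      (forall v : E k, g (mu [:: hv (g v)] k) = g v).
    have [|d dE] := @linear_ex _ (E n) (E k) (fun v => mu [:: hv v] k).
      by move=> a u v; exact: (muM [::] [::]).
    have [g [dgd gdg]] := generalized_inverse d.
    by exists g; split=> v; rewrite -!dE.
  by exists (fun k n => projT1 (cid (ex k n))) => n k; case: (cid _).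
have mu_h_mu n k := (hP n k).1; have h_mu_h n k := (hP n k).2.
have tlin n := linear_ex (@tproj_linear _ _ _ muS h n).
pose tproj n := projT1 (cid (tlin n)).
have tprojE n v : tproj n v = h (n + 1) n (mu [:: hv v] (n + 1)) + dh mu h v.
  exact: (projT2 (cid (tlin n))).
have aS := alpha_sym muS h.
have a_exact x y n : alpha mu h [:: value 1 mu [:: x]; y] n = 0 by exact: alpha_exact.
exists (alpha mu h); split=> //; first exact: nijenhuis_euler_plus.
rewrite bracket_euler_plus //.
exact: (exists_splitting sparseE muS mu_flat jacobi mu_h_mu h_mu_h tprojE).
Qed.
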